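(* Let $K$ be a torsion free word hyperbolic linear group. Then there exists a constant $k>1$ such that, for any non-proper HNN extension $G=K\rtimes\mathbb{Z}$ of $K$, we have $\omega(S)\geq k$ for every finitely generated subgroup $S$ of $G$ that is not isomorphic to $\{e\}$, $\mathbb{Z}$, $\mathbb{Z}\times\mathbb{Z}$ or the Klein bottle group.
   Context: For a finitely generated group $G$ and a finite generating set $A$ of $G$, let $\gamma_A(n)$ be the number of elements of $G$ of word length at most $n$ with respect to $A\cup A^{-1}$, and let $\omega(G,A)=\lim_{n\to\infty}\gamma_A(n)^{1/n}$ (the limit exists since $\gamma_A$ is submultiplicative). The growth constant of $G$ is $\omega(G)=\inf_A \omega(G,A)$, the infimum being over all finite generating sets $A$ of $G$. A non-proper HNN extension of $K$ is a semidirect product $K\rtimes_\alpha\mathbb{Z}=\langle K,t\mid tkt^{-1}=\alpha(k)\ (k\in K)\rangle$ for an automorphism $\alpha$ of $K$. A linear group is a group isomorphic to a subgroup of $GL_d(\mathbb{F})$ for some integer $d\geq 1$ and some field $\mathbb{F}$. The Klein bottle group is $\langle a,t\mid tat^{-1}=a^{-1}\rangle$. *)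

(* Defs.v *)
From HB Require Import structures.
From mathcomp Require Import all_boot all_order all_algebra.
From mathcomp Require Import finmap.
From mathcomp Require Import all_classical all_reals all_analysis.

Set Implicit Arguments.
Unset Strict Implicit.
Unset Printing Implicit Defensive.

Import Order.TTheory GRing.Theory Num.Theory.
Import numFieldNormedType.Exports.

Local Open Scope classical_set_scope.
Local Open Scope group_scope.

(* Groups, possibly infinite, are MathComp's [groupType]s, in multiplicative
   notation.  A subgroup of [G] is a set of elements of [G]. *)

Section Subgroups.
Variable G : groupType.

Definition is_subgroup (S : set G) : Prop :=
  S 1 /\ forall x y, S x -> S y -> S (x / y).

Definition is_word (A : set G) (w : seq G) : Prop :=
  forall a, a \in w -> A a \/ A a^-1.

Definition generated (A : set G) : set G :=
  [set x | exists2 w, is_word A w & x = \prod_(a <- w) a].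

Definition fin_gen (A S : set G) : Prop := finite_set A /\ generated A = S.

Definition finitely_generated (S : set G) : Prop := exists A, fin_gen A S.

Definition spelled_by (A : set G) (x : G) (n : nat) : Prop :=
  exists w, [/\ is_word A w, size w = n & x = \prod_(a <- w) a].

(* The value is meaningful only on [generated A]; it is 0 elsewhere. *)
Definition word_length (A : set G) (x : G) : nat :=
  if pselect (exists n, `[< spelled_by A x n >]) is left ex_n then ex_minn ex_n
  else 0%N.

Definition word_dist (A : set G) (x y : G) : nat := word_length A (x^-1 * y).

(* For [A] finite the balls are finite, so [fset_set] is not degenerate. *)
Definition growth_function (A : set G) (n : nat) : nat :=
  #|` fset_set [set x | generated A x /\ (word_length A x <= n)%N] |%fset.

(* The term of index 0 is irrelevant: there [n%:R^-1] is 0. *)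
Definition growth_rate (R : realType) (A : set G) : R :=
  limn (fun n : nat => ((growth_function A n)%:R `^ (n%:R^-1))%R : R).

Definition growth_constant (R : realType) (S : set G) : R :=
  inf [set growth_rate R A | A in [set A | fin_gen A S]].

Definition isom_to (H : groupType) (S : set G) : Prop :=
  exists f : {multiplicative H -> G}, injective f /\ range f = S.

End Subgroups.

Definition torsion_free (G : groupType) : Prop :=
  forall (x : G) n, (0 < n)%N -> x ^+ n = 1 -> x = 1.

(* An injective homomorphism to GL_d(F), for some d and F. *)
Definition linear_group (G : groupType) : Prop :=
  exists (F : fieldType) (d : nat) (rho : G -> 'M[F]_d),
    [/\ (0 < d)%N, forall x, rho x \in unitmx,
        forall x y, rho (x * y) = (rho x *m rho y)%R & injective rho].

Definition gromov_product (R : realType) (G : groupType) (A : set G)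
    (w x y : G) : R :=
  (((word_dist A w x)%:R + (word_dist A w y)%:R - (word_dist A x y)%:R) / 2)%R.

(* Gromov's definition: a finitely generated group whose word metric, for some
   (equivalently, any) finite generating set, is a hyperbolic metric. *)
Definition word_hyperbolic (R : realType) (G : groupType) : Prop :=
  exists A : set G, fin_gen A [set: G] /\
    exists delta : R, forall w x y z : G,
      (Num.min (gromov_product R A w x y) (gromov_product R A w y z) - delta
         <= gromov_product R A w x z)%R.

Record group_aut (K : groupType) := GroupAut {
  gaut :> {multiplicative K -> K};
  gautV : K -> K;
  gautK : cancel gaut gautV;
  gautVK : cancel gautV gaut }.

Definition iterz (T : Type) (f fV : T -> T) (n : int) : T -> T :=
  match n with Posz m => iter m f | Negz m => iter m.+1 fV end.

Lemma Posz_succ (n : nat) : (n.+1%:Z = n%:Z + 1)%R.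
Proof. by rewrite intS addrC. Qed.

Lemma Posz_oppS (n : nat) : (- n.+1%:Z = - n%:Z - 1)%R.
Proof. by rewrite Posz_succ opprD. Qed.

Section IterZ.
Variables (T : Type) (f fV : T -> T).
Hypotheses (fK : cancel f fV) (fVK : cancel fV f).

Lemma iterzS n x : iterz f fV (n + 1)%R x = f (iterz f fV n x).
Proof.
case: n => n; first by rewrite -Posz_succ.
case: n => [|n]; first by rewrite /= fVK.
have -> : (Negz n.+1 + 1)%R = Negz n by rewrite !NegzE Posz_oppS subrK.
by rewrite /iterz [in RHS]iterS fVK.
Qed.

Lemma iterz_pred n x : iterz f fV (n - 1)%R x = fV (iterz f fV n x).
Proof. by rewrite -[in RHS](subrK 1%R n) iterzS fK. Qed.

Lemma iterzD m n x : iterz f fV (m + n)%R x = iterz f fV m (iterz f fV n x).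
Proof.
elim/int_ind: m => [|m IH|m IH]; first by rewrite add0r.
- by rewrite (Posz_succ m) addrAC !iterzS IH.
- by rewrite Posz_oppS addrAC !iterz_pred IH.
Qed.

End IterZ.

Section IntegerPowers.
Variables (G : groupType) (x : G).

Definition expgz (n : int) : G := iterz ( *%g x) ( *%g x^-1) n 1.

Lemma expgzS n : expgz (n + 1)%R = x * expgz n.
Proof. exact: iterzS (mulVKg x) _ _. Qed.

Lemma expgz_pred n : expgz (n - 1)%R = x^-1 * expgz n.
Proof. exact: iterz_pred (mulKg x) (mulVKg x) _ _. Qed.

Lemma expgz1 : expgz 1 = x. Proof. exact: mulg1. Qed.

Lemma expgzD m n : expgz (m + n)%R = expgz m * expgz n.
Proof.
elim/int_ind: m => [|m IH|m IH]; first by rewrite add0r mul1g.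
- by rewrite (Posz_succ m) addrAC !expgzS IH mulgA.
- by rewrite Posz_oppS addrAC !expgz_pred IH mulgA.
Qed.

End IntegerPowers.

(* The semidirect product of K and Z along alpha: [HNN k n] stands for k t^n,
   with t k t^-1 = alpha k. *)
Record hnn (K : groupType) (alpha : group_aut K) :=
  HNN { hnn_base : K; hnn_exp : int }.
Arguments HNN {K} alpha _ _.

Section HNNGroup.
Variables (K : groupType) (alpha : group_aut K).

Definition pair_of_hnn (x : hnn alpha) : K * int := (hnn_base x, hnn_exp x).
Definition hnn_of_pair (p : K * int) : hnn alpha := HNN alpha p.1 p.2.
Lemma pair_of_hnnK : cancel pair_of_hnn hnn_of_pair. Proof. by case. Qed.
HB.instance Definition _ := Choice.copy (hnn alpha) (can_type pair_of_hnnK).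

Definition gautz (n : int) : K -> K := iterz alpha (gautV alpha) n.

Definition hnn_one : hnn alpha := HNN alpha 1 0%R.
Definition hnn_mul (x y : hnn alpha) : hnn alpha :=
  HNN alpha (hnn_base x * gautz (hnn_exp x) (hnn_base y))
    (hnn_exp x + hnn_exp y)%R.
Definition hnn_inv (x : hnn alpha) : hnn alpha :=
  HNN alpha (gautz (- hnn_exp x)%R (hnn_base x)^-1) (- hnn_exp x)%R.

Lemma gautVM : {morph gautV alpha : x y / x * y}.
Proof.
by move=> x y; apply: (can_inj (gautK alpha)); rewrite gmulfM !gautVK.
Qed.

Lemma gautzM n : {morph gautz n : x y / x * y}.
Proof.
move=> x y; elim/int_ind: n => [|n IH|n IH] //; rewrite /gautz.
- by rewrite (Posz_succ n) !(iterzS (gautVK alpha)) [iterz _ _ _ _]IH gmulfM.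
- rewrite Posz_oppS !(iterz_pred (gautK alpha) (gautVK alpha)).
  by rewrite [iterz _ _ _ _]IH gautVM.
Qed.

Lemma gautz1 n : gautz n 1 = 1.
Proof. by apply: (mulgI (gautz n 1)); rewrite -gautzM !mulg1. Qed.

Lemma gautzD m n x : gautz (m + n)%R x = gautz m (gautz n x).
Proof. exact: iterzD (gautK alpha) (gautVK alpha) m n x. Qed.

Lemma hnn_mulA : associative hnn_mul.
Proof.
move=> [x m] [y n] [z p]; rewrite /hnn_mul /=.
by rewrite gautzM gautzD mulgA addrA.
Qed.
Lemma hnn_mul1 : left_id hnn_one hnn_mul.
Proof. by move=> [x m]; rewrite /hnn_mul /= mul1g add0r. Qed.
Lemma hnn_mulr1 : right_id hnn_one hnn_mul.
Proof. by move=> [x m]; rewrite /hnn_mul /= gautz1 mulg1 addr0. Qed.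
Lemma hnn_mulV : left_inverse hnn_one hnn_inv hnn_mul.
Proof.
by move=> [x m]; rewrite /hnn_mul /= -gautzM mulVg gautz1 addNr.
Qed.
Lemma hnn_mulrV : right_inverse hnn_one hnn_inv hnn_mul.
Proof.
by move=> [x m]; rewrite /hnn_mul /= -gautzD subrr [gautz 0 _]/= mulgV.
Qed.

HB.instance Definition _ := isGroup.Build (hnn alpha)
  hnn_mulA hnn_mul1 hnn_mulr1 hnn_mulV hnn_mulrV.

Definition hnn_in (k : K) : hnn alpha := HNN alpha k 0%R.
Definition hnn_t : hnn alpha := HNN alpha 1 1%R.

Lemma hnn_inM : {morph hnn_in : x y / x * y}. Proof. by []. Qed.
HB.instance Definition _ := isMultiplicative.Build K (hnn alpha) hnn_in hnn_inM.

Lemma hnn_conj k : hnn_t * hnn_in k * hnn_t^-1 = hnn_in (alpha k).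
Proof.
rewrite /hnn_t /hnn_in; congr HNN.
by rewrite /= mul1g -[X in _ * X]/(gautz (1 + 0)%R (gautz (- 1)%R 1^-1))
  invg1 !gautz1 mulg1.
Qed.

Lemma hnn_expz n : expgz hnn_t n = HNN alpha 1 n.
Proof.
elim/int_ind: n => [|n IH|n IH] //.
- rewrite (Posz_succ n) expgzS IH; congr HNN; last exact: addrC.
  by rewrite mul1g -[LHS]/(gautz 1 1) gautz1.
- rewrite Posz_oppS expgz_pred IH; congr HNN; last exact: addrC.
  by rewrite -[LHS]/(gautz (-1)%R 1^-1 * gautz (-1)%R 1) invg1 gautz1 mulg1.
Qed.

Lemma hnn_decomp x : x = hnn_in (hnn_base x) * expgz hnn_t (hnn_exp x).
Proof.
rewrite hnn_expz; case: x => k n; congr HNN; last by rewrite add0r.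
by rewrite -[RHS]/(k * 1) mulg1.
Qed.

(* [hnn alpha] has the presentation <K, t | t k t^-1 = alpha k>. *)
Lemma hnn_presentation (H : groupType) (f : {multiplicative K -> H}) (s : H) :
    (forall k, s * f k * s^-1 = f (alpha k)) ->
  exists g : {multiplicative hnn alpha -> H},
    [/\ g hnn_t = s, forall k, g (hnn_in k) = f k &
        forall g' : {multiplicative hnn alpha -> H},
          g' hnn_t = s -> (forall k, g' (hnn_in k) = f k) -> g' =1 g].
Proof.
move=> fs.
have fS k : s * f k = f (alpha k) * s by rewrite -fs mulgVK.
have fV k : s^-1 * f k = f (gautV alpha k) * s^-1.
  by apply: (mulgI s); rewrite mulVKg mulgA fS gautVK mulgK.
have fZ m k : expgz s m * f k = f (gautz m k) * expgz s m.
  elim/int_ind: m => [|m IH|m IH]; rewrite /gautz.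
  - by rewrite mul1g mulg1.
  - rewrite (Posz_succ m) expgzS (iterzS (gautVK alpha)) -mulgA IH.
    by rewrite mulgA fS mulgA.
  - rewrite Posz_oppS expgz_pred.
    rewrite (iterz_pred (gautK alpha) (gautVK alpha)) -mulgA IH.
    by rewrite mulgA fV mulgA.
pose g (x : hnn alpha) := f (hnn_base x) * expgz s (hnn_exp x).
have gM : {morph g : x y / x * y}.
  move=> [k m] [l n]; rewrite /g /= gmulfM expgzD -!mulgA; congr (_ * _).
  by rewrite !mulgA fZ.
have f1 : f 1 = 1 by apply: (mulgI (f 1)); rewrite -gmulfM !mulg1.
pose gB := isMultiplicative.Build _ _ g gM.
exists (HB.pack g gB : {multiplicative hnn alpha -> H}); split => /=.
- by rewrite /g f1 mul1g; exact: expgz1.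
- by move=> k; rewrite /g /= mulg1.
move=> g' g't g'k x; rewrite {1}[x]hnn_decomp gmulfM g'k; congr (_ * _).
have g'1 : g' 1 = 1 by apply: (mulgI (g' 1)); rewrite -gmulfM !mulg1.
elim/int_ind: (hnn_exp x) => [|n IH|n IH]; rewrite ?g'1 //.
- by rewrite (Posz_succ n) !expgzS gmulfM IH g't.
- rewrite Posz_oppS !expgz_pred gmulfM IH; congr (_ * _).
  by apply: (mulgI s); rewrite -{1}g't -gmulfM !mulgV.
Qed.

End HNNGroup.

Notation Zgroup := (Algebra.to_multiplicative int).

Definition Zinv (n : Zgroup) : Zgroup := n^-1.
Lemma ZinvM : {morph Zinv : m n / m * n}.
Proof. exact: opprD. Qed.
HB.instance Definition _ := isMultiplicative.Build Zgroup Zgroup Zinv ZinvM.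

Definition Zinv_aut : group_aut Zgroup :=
  @GroupAut Zgroup Zinv Zinv (@opprK int) (@opprK int).

(* <a, t | t a t^-1 = a^-1> is the extension of the infinite cyclic group <a>
   in which t acts by inversion. *)
Definition Klein_bottle_group : groupType := hnn Zinv_aut.
Definition Klein_a : Klein_bottle_group := hnn_in Zinv_aut (1%R : int).
Definition Klein_t : Klein_bottle_group := hnn_t Zinv_aut.

Lemma Klein_relation : Klein_t * Klein_a * Klein_t^-1 = Klein_a^-1.
Proof. by rewrite [LHS]hnn_conj. Qed.

Lemma Klein_presentation (H : groupType) (b s : H) :
    s * b * s^-1 = b^-1 ->
  exists g : {multiplicative Klein_bottle_group -> H},
    [/\ g Klein_t = s, g Klein_a = b &
        forall g' : {multiplicative Klein_bottle_group -> H},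
          g' Klein_t = s -> g' Klein_a = b -> g' =1 g].
Proof.
move=> sb.
have sbV : s * b^-1 * s^-1 = b by apply: (can_inj invgK); rewrite !invgM !invgK mulgA.
have fM : {morph (expgz b : Zgroup -> H) : m n / m * n} by move=> m n; exact: (@expgzD H b m n).
pose fB := isMultiplicative.Build Zgroup H (expgz b) fM.
pose f := HB.pack (expgz b : Zgroup -> H) fB : {multiplicative Zgroup -> H}.
have sf n : s * expgz b n * s^-1 = expgz b (- n)%R.
  elim/int_ind: n => [|n IH|n IH]; first by rewrite oppr0 mulg1 mulgV.
  - rewrite Posz_oppS expgz_pred -IH (Posz_succ n) expgzS -sb.
    by rewrite !mulgA mulgVK.
  - rewrite Posz_oppS expgz_pred opprB addrC expgzS -IH -[X in X * (_ / _)]sbV.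
    by rewrite !mulgA mulgVK.
have [g [gt gf gU]] := @hnn_presentation _ Zinv_aut H f s sf.
exists g; split=> //; first by rewrite gf; exact: expgz1.
move=> g' g't g'a; apply: gU => // n /=.
have g'1 : g' 1 = 1 by apply: (mulgI (g' 1)); rewrite -gmulfM !mulg1.
have inD (m p : int) : hnn_in Zinv_aut (m + p)%R = hnn_in Zinv_aut m * hnn_in Zinv_aut p.
  exact: hnn_inM.
have g'aV : g' (hnn_in Zinv_aut (-1)%R) = b^-1.
  by apply: (mulgI b); rewrite -{1}g'a -gmulfM -inD subrr mulgV.
elim/int_ind: n => [|n IH|n IH]; first exact: g'1.
- rewrite (Posz_succ n) expgzS addrC inD gmulfM IH; congr (_ * _); exact: g'a.
- by rewrite Posz_oppS expgz_pred addrC inD gmulfM IH g'aV.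
Qed.

Definition trivial_group : groupType := Algebra.to_multiplicative 'I_1.

(* Main.v *)
(* Let [K] be torsion free and hyperbolic.  Some power [x^j] of each [x <> 1], with
   [j] bounded in terms of [K] only, translates along a quasi-geodesic axis by a distance
   that is large compared with the hyperbolicity constant: otherwise too many powers of
   [x] would move a point deep inside a geodesic from 1 to [x^n] by a bounded amount.
   Consequently [<x>] has finite index in the centralizer of [x], and the transfer into
   [<x>] embeds this centralizer into Z.

   If [y] does not commute with [x], the axes of [x^j] and [y x^j y^-1] cannot stay close
   for more than a bounded number of periods, because a pigeonhole argument would
   then give [y x^m y^-1 = x^m] or [x^-m] for some [m > 0].  By ping-pong, [x^k] and
   [y x^k y^-1] freely generate a semigroup for a bounded [k].

   Let [S] be a subgroup of the extension of [K] by Z, generated by [A].  Either two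
   noncommuting elements of [K] have length at most 6 over [A], or the intersection of
   [S] with [K] is cyclic: when [c = [a, b]] is a nontrivial commutator of generators
   and each [s c s^-1] commutes with [c], the relation of commuting propagates to
   [S], whence [S] intersected with [K] lies in the centralizer of [c]. *)
Require Import Defs.
From HB Require Import structures.
From mathcomp Require Import all_boot all_order all_algebra.
From mathcomp Require Import finmap.
From mathcomp Require Import all_classical all_reals all_analysis.
From mathcomp Require Import zify lra.
Set Implicit Arguments.
Unset Strict Implicit.
Unset Printing Implicit Defensive.
Import Order.TTheory GRing.Theory Num.Theory.
Import numFieldNormedType.Exports.
Local Open Scope classical_set_scope.
Local Open Scope group_scope.

(** * Hyperbolic length functions *)

(* The various inheritance paths to a group operation are convertible but not
   syntactically equal, which hides equal terms from [lia]. *)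
Ltac gnorm K :=
  let mK := constr:(monoid_Group__to__monoid_Magma K) in
  let iK := constr:(monoid_Group__to__monoid_BaseGroup K) in
  let uK := constr:(monoid_Group__to__monoid_BaseUMagma K) in
  repeat match goal with
  | |- context [@monoid.mul ?M] => lazymatch M with
    | monoid_Group__to__monoid_Magma _ => fail
    | _ => change (@monoid.mul M) with (@monoid.mul mK) in * end
  | |- context [@monoid.inv ?M] => lazymatch M with
    | monoid_Group__to__monoid_BaseGroup _ => fail
    | _ => change (@monoid.inv M) with (@monoid.inv iK) in * end
  | |- context [@monoid.one ?M] => lazymatch M with
    | monoid_Group__to__monoid_BaseUMagma _ => fail
    | _ => change (@monoid.one M) with (@monoid.one uK) in * end
  | |- context [@monoid.natexp ?M] => lazymatch M with
    | monoid_Group__to__monoid_BaseUMagma _ => fail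
    | _ => change (@monoid.natexp M) with (@monoid.natexp uK) in * end
  | H : context [@monoid.mul ?M] |- _ => lazymatch M with
    | monoid_Group__to__monoid_Magma _ => fail
    | _ => change (@monoid.mul M) with (@monoid.mul mK) in * end
  | H : context [@monoid.inv ?M] |- _ => lazymatch M with
    | monoid_Group__to__monoid_BaseGroup _ => fail
    | _ => change (@monoid.inv M) with (@monoid.inv iK) in * end
  | H : context [@monoid.one ?M] |- _ => lazymatch M with
    | monoid_Group__to__monoid_BaseUMagma _ => fail
    | _ => change (@monoid.one M) with (@monoid.one uK) in * end
  | H : context [@monoid.natexp ?M] |- _ => lazymatch M with
    | monoid_Group__to__monoid_BaseUMagma _ => fail
    | _ => change (@monoid.natexp M) with (@monoid.natexp uK) in * end
  end.

Section GromovProduct.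
Variables (K : groupType) (len : K -> nat) (D : nat).

Local Ltac glia := gnorm K; lia.

Definition dist (x y : K) : nat := len (x^-1 * y).

(* Twice the Gromov product of [x] and [y] at [o]. *)
Definition gp (o x y : K) : nat := (dist o x + dist o y - dist x y)%N.

Definition hyperbolic_length : Prop :=
  [/\ len 1 = 0%N, forall x, len x^-1 = len x,
      forall x y, (len (x * y) <= len x + len y)%N &
      forall o x y z, (minn (gp o x y) (gp o y z) <= gp o x z + D)%N].

Hypothesis hL : hyperbolic_length.

Lemma len1 : len 1 = 0%N. Proof. by case: hL. Qed.
Lemma lenV (x : K) : len x^-1 = len x. Proof. by case: hL. Qed.
Lemma lenM (x y : K) : (len (x * y) <= len x + len y)%N. Proof. by case: hL. Qed.
Lemma gp_hyp o x y z : (minn (gp o x y) (gp o y z) <= gp o x z + D)%N.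
Proof. by case: hL. Qed.

Lemma dist1 (x : K) : dist 1 x = len x. Proof. by rewrite /dist invg1 mul1g. Qed.
Lemma distC (x y : K) : dist x y = dist y x.
Proof. by rewrite /dist -lenV invgM invgK. Qed.
Lemma distM (g x y : K) : dist (g * x) (g * y) = dist x y.
Proof. by rewrite /dist invgM -mulgA mulKg. Qed.
Lemma dist_triangle (y x z : K) : (dist x z <= dist x y + dist y z)%N.
Proof. by have := lenM (x^-1 * y) (y^-1 * z); rewrite mulgA mulgK. Qed.

Lemma gpE o x y : (gp o x y + dist x y)%N = (dist o x + dist o y)%N.
Proof. by rewrite /gp subnK // (distC o x) dist_triangle. Qed.

Lemma gpC o x y : gp o x y = gp o y x.
Proof. by rewrite /gp (distC x y) addnC. Qed.

Lemma gpM (g o x y : K) : gp (g * o) (g * x) (g * y) = gp o x y.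
Proof. by rewrite /gp !distM. Qed.

(** In the tree picture, the branch towards [y] leaves the segment from [o] to [x] at one point, and
    the two products measure, doubled, the two pieces of the segment. *)
Lemma gp_flip o x y : (gp o x y + gp x o y)%N = (2 * dist o x)%N.
Proof. have := gpE o x y; have := gpE x o y; rewrite (distC x o); glia. Qed.

Lemma gp_flip1 (a w : K) : (gp 1 a (a * w) + gp 1 a^-1 w = 2 * len a)%N.
Proof.
have := gp_flip 1 a (a * w); rewrite dist1 -(gpM a^-1 a) mulVg mulKg.
by rewrite mulg1.
Qed.

Lemma gp_le o x y : (gp o x y <= 2 * dist o x)%N.
Proof. by rewrite -(gp_flip o x y) leq_addr. Qed.

Lemma gp1_le x y : (gp 1 x y <= 2 * len x)%N.
Proof. by rewrite -dist1 gp_le. Qed.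

Lemma gp11 x : gp 1 1 x = 0%N.
Proof. by have := gp1_le 1 x; rewrite len1; glia. Qed.

Lemma gp_baseD o' o x y : (gp o x y <= gp o' x y + 2 * dist o o')%N.
Proof.
have := gpE o x y; have := gpE o' x y.
have := dist_triangle o' o x; have := dist_triangle o' o y; glia.
Qed.

Lemma gp_rD x' o x y : (gp o y x <= gp o y x' + 2 * dist x x')%N.
Proof.
have := gpE o y x; have := gpE o y x'.
have := dist_triangle x' o x; have := dist_triangle x y x'; rewrite (distC x' x); glia.
Qed.

(* [along a w r]: a geodesic from 1 to [w] passes close to [a]. *)
Definition along (w a : K) (r : nat) : Prop :=
  (2 * len a <= gp 1 a w + r + D)%N.

Lemma along_refl (a : K) r : along a a r.
Proof. rewrite /along /gp !dist1 /dist mulVg len1; glia. Qed.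

(* The local-to-global principle for broken geodesics: prepending one edge. *)
Lemma along_cons (w a b : K) ra rb : along w b rb -> (rb + D < len b)%N ->
    (gp 1 a^-1 b <= minn ra rb)%N ->
  [/\ (gp 1 a^-1 w <= minn ra rb + D)%N, along (a * w) a ra &
      (len a + len w <= len (a * w) + ra + D)%N].
Proof.
move=> hw hb hab.
have aw : (gp 1 a^-1 w <= minn ra rb + D)%N.
  have := gp_hyp 1 a^-1 w b; rewrite (gpC 1 w b) => H.
  move: hw; rewrite /along; glia.
split => //; first by have := gp_flip1 a w; rewrite /along; glia.
have := gpE 1 a^-1 w; rewrite !dist1 lenV.
by rewrite /dist invgK; glia.
Qed.


(** * Powers of elements with a quasi-geodesic axis *)

Lemma lenX (x : K) n : (len (x ^+ n) <= n * len x)%N.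
Proof.
elim: n => [|n IH]; first by rewrite expg0 len1.
by rewrite expgS mulSn (leq_trans (lenM _ _)) // leq_add2l.
Qed.

(** The small corner at 1 and the large length make the powers of [g] a quasi-geodesic through 1.
    The constant 7 is the one that [axial_of_deep_point] yields; the constants 100 leave room for
    the errors accumulated below, also when [D = 0]. *)
Definition axial (g : K) : Prop :=
  (gp 1 g^-1 g <= 7 * D)%N /\ (100 * D + 100 <= len g)%N.

Lemma axialV (g : K) : axial g -> axial g^-1.
Proof. by rewrite /axial invgK gpC lenV. Qed.

Lemma axial_step (g w : K) : axial g -> along w g (7 * D) ->
  [/\ (gp 1 g^-1 w <= 8 * D)%N, along (g * w) g (7 * D) &
      (len g + len w <= len (g * w) + 8 * D)%N].
Proof.
move=> [h1 h2] hw.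
have hb : (7 * D + D < len g)%N by glia.
have hab : (gp 1 g^-1 g <= minn (7 * D) (7 * D))%N by glia.
by have [a b c] := along_cons hw hb hab; split => //; glia.
Qed.

Lemma axial_along (g : K) n : axial g -> along (g ^+ n.+1) g (7 * D).
Proof.
move=> hg; elim: n => [|n IH]; first exact: along_refl.
by rewrite expgS; have [] := axial_step hg IH.
Qed.

Lemma axial_cons (g : K) n : axial g ->
  (gp 1 g^-1 (g ^+ n) <= 8 * D)%N /\
  (len g + len (g ^+ n) <= len (g ^+ n.+1) + 8 * D)%N.
Proof.
move=> hg; case: n => [|n].
  by rewrite expg0 expg1 len1 gpC gp11; split; glia.
rewrite (expgS g n.+1); have [h1 h2] := hg.
by have [a _ c] := axial_step hg (axial_along n hg).
Qed.

(** Each new factor loses at most [8 * D], which is less than half of [len g]. *)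
Lemma axial_lenX (g : K) n : axial g -> (n * len g <= 2 * len (g ^+ n))%N.
Proof.
move=> hg; elim: n => [|n IH] //.
have [_] := axial_cons n hg; case: hg => _; rewrite mulSn; glia.
Qed.

(** The path to [g ^+ n] starts along [g], which diverges from [g ^- m] by [axial_cons] applied to
    [g^-1]; hyperbolicity adds one [D]. *)
Lemma axial_gpX (g : K) m n : axial g -> (gp 1 (g ^- m) (g ^+ n) <= 9 * D)%N.
Proof.
move=> hg; case: m => [|m].
  by rewrite expg0 invg1 gp11.
case: n => [|n].
  by rewrite expg0 gpC gp11.
have hgV := axialV hg.
have := axial_along n hg; rewrite /along => al.
have [+ _] := axial_cons m.+1 hgV; rewrite invgK expVgn gpC => h.
have := gp_hyp 1 (g ^- m.+1) (g ^+ n.+1) g; rewrite (gpC 1 (g ^+ n.+1)).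
case: hg => _ h2; glia.
Qed.

Lemma axial_lenD (g : K) m n : axial g ->
  (len (g ^+ m) + len (g ^+ n) <= len (g ^+ (m + n)) + 9 * D)%N.
Proof.
move=> hg; have := axial_gpX m n hg; have := gpE 1 (g ^- m) (g ^+ n).
by rewrite !dist1 lenV /dist invgK -expgnDr; glia.
Qed.

Lemma axial_gp_prefix (g : K) m n : axial g ->
  (2 * len (g ^+ m) <= gp 1 (g ^+ m) (g ^+ (m + n)) + 9 * D)%N.
Proof.
move=> hg; have := axial_gpX m n hg.
by have := gp_flip1 (g ^+ m) (g ^+ n); rewrite -expgnDr; glia.
Qed.

(** Seen from [q], the points [x] and [x'] lie in the same direction, so that exchanging them costs
    one [D]. *)
Lemma gp_shift e (q x x' y : K) :
  (e + D < gp q x x')%N -> (gp q x' y <= e)%N -> (gp q x y <= e + D)%N.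
Proof. have := gp_hyp q x' x y; rewrite (gpC q x' x); glia. Qed.

Lemma gp_far (q x x' : K) : (2 * dist q x <= gp q x x' + 2 * dist x x')%N.
Proof. have := gpE q x x'; have := dist_triangle x' q x; rewrite (distC x' x); glia. Qed.

(** * Uniform existence of axial powers *)

Definition finite_balls : Prop :=
  forall n, exists s : seq K, forall x, (len x <= n)%N -> x \in s.

Definition geodesic_length : Prop :=
  forall x k, (k <= len x)%N -> exists p, len p = k /\ (len (p^-1 * x) + k = len x)%N.

Lemma ball_pigeonhole : finite_balls -> forall n, exists M, forall f : nat -> K,
  (forall i, (i <= M)%N -> (len (f i) <= n)%N) ->
  exists i j, [/\ (i < j)%N, (j <= M)%N & f i = f j].
Proof.
move=> fin n; have [s hs] := fin n; exists (size s) => f hf.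
pose l := map f (iota 0 (size s).+1).
have sub : {subset l <= s}.
  by move=> x /mapP[i]; rewrite mem_iota => hi ->; apply/hs/hf; glia.
have nu : ~~ uniq l.
  by apply/negP => /uniq_leq_size /(_ sub); rewrite size_map size_iota ltnn.
have [i [j [lt_ij]]] := uniqPn (f 0) nu.
rewrite size_map size_iota ltnS => hj.
have hi : (i < (size s).+1)%N by glia.
by rewrite !(nth_map 0) ?size_iota // !nth_iota // !add0n; exists i, j.
Qed.

Lemma expg_inj_torsion_free (x : K) i j : torsion_free K -> x != 1 ->
  x ^+ i = x ^+ j -> i = j.
Proof.
move=> tf x1; wlog ij : i j / (i <= j)%N.
  by case/orP: (leq_total i j) => [/[swap]/[apply]//|] h /(_ _ _ h) H /esym/H.
move=> e; apply/eqP; rewrite eqn_leq ij /= leqNgt; apply/negP => lt.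
case/eqP: x1; apply: (tf _ (j - i)%N); first by rewrite subn_gt0.
by rewrite expgnFr // e mulgV.
Qed.

(* As [F] commutes with [g], the ends of a geodesic from 1 to [F] are moved by at
   most [R], so that [g] slides its deep points along it. *)
Lemma axial_of_deep_point (g p F : K) R : commute g F -> (len g <= R)%N ->
    (100 * D + 100 <= len (p^-1 * g * p))%N ->
    (len (p^-1 * F) + len p = len F)%N ->
    (3 * R + 10 * D + 10 <= len p)%N -> (3 * R + 10 * D + 10 <= len (p^-1 * F))%N ->
  axial (p^-1 * g * p).
Proof.
move=> gF gR hlong geo kp kF; split => //.
have line0 : gp p 1 F = 0%N.
  by have := gpE p 1 F; rewrite dist1 (distC p 1) dist1 {1}/dist; glia.
(* Translation by [c] moves both ends 1 and [F] of the geodesic by [len c] only, since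
   [c * F = F * c]; the image [c * p] of a deep point therefore stays near the original geodesic. *)
have line (c : K) : commute c F -> (len c <= R)%N -> (gp (c * p) 1 F <= 2 * D)%N.
  move=> cF cR.
  have e0 : gp (c * p) c (c * F) = 0%N by rewrite -{2}(mulg1 c) gpM.
  have dc1 : dist (c * p) c = len p by rewrite -{2}(mulg1 c) distM distC dist1.
  have dcF : dist (c * p) (c * F) = len (p^-1 * F) by rewrite distM.
  have d1 : dist 1 c = len c by rewrite dist1.
  have dF : dist F (c * F) = len c by rewrite /dist cF mulKg.
  have h1 := gp_far (c * p) c 1; rewrite (distC c) d1 dc1 in h1.
  have h2 := gp_far (c * p) (c * F) F; rewrite (distC _ F) dF dcF in h2.
  have a1 : (gp (c * p) 1 (c * F) <= 0 + D)%N.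
    by apply: (@gp_shift _ _ _ c); rewrite ?e0 // gpC; glia.
  have : (gp (c * p) F 1 <= 0 + D + D)%N.
    by apply: (@gp_shift _ _ _ (c * F)); rewrite // gpC //; glia.
  by rewrite gpC; glia.
(* Both [p] and [g * p] are near the geodesic from 1 to [F], so their distance is nearly the
   difference of their distances to 1. From [g^-1], which is close to 1 compared with [len p], the
   points [p] and [g^-1 * p] are at distances [len (g * p)] and [len p]. Hence [g^-1 * p] and
   [g * p] lie on opposite sides of [p]. *)
have l1 := line g gF gR.
have f1 := gp_flip 1 p F; rewrite line0 dist1 in f1.
have f2 := gp_flip 1 (g * p) F; rewrite dist1 in f2.
have h1 := gp_hyp 1 p F (g * p); rewrite (gpC 1 F) in h1.
have e1 := gpE 1 p (g * p); rewrite !dist1 /dist mulgA in e1.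
have t1 := lenM g p.
have t2 : (len p <= len g + len (g * p))%N.
  by have := lenM g^-1 (g * p); rewrite mulKg lenV.
have e2 := gpE 1 p g^-1; rewrite !dist1 lenV in e2.
have d2 : dist p g^-1 = len (g * p) by rewrite distC /dist invgK.
have e3 := gpE 1 g^-1 (g^-1 * p); rewrite !dist1 lenV in e3.
have d3 : dist g^-1 (g^-1 * p) = len p.
  by rewrite -{1}(mulg1 g^-1) distM dist1.
have e4 := gpE 1 p (g^-1 * p); rewrite !dist1 in e4.
have d4 : dist p (g^-1 * p) = len (p^-1 * g * p).
  by rewrite /dist -lenV !invgM !invgK.
have h2 := gp_hyp 1 p g^-1 (g^-1 * p).
have h3 := gp_hyp 1 g^-1 p (g^-1 * p); rewrite (gpC 1 g^-1 p) in h3.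
have h4 := gp_hyp 1 g^-1 (g^-1 * p) p; rewrite (gpC 1 (g^-1 * p)) (gpC 1 g^-1 p) in h4.
have e5 := gpE 1 (p^-1 * g * p)^-1 (p^-1 * g * p); rewrite !dist1 lenV in e5.
have d5 : dist (p^-1 * g * p)^-1 (p^-1 * g * p) = dist (g^-1 * p) (g * p).
  by rewrite /dist !invgM !invgK !mulgA mulgK.
have t3 := dist_triangle (g * p) 1 (g^-1 * p); rewrite !dist1 in t3.
have t4 := dist_triangle (g^-1 * p) 1 (g * p); rewrite !dist1 in t4.
rewrite (distC (g * p)) in t3.
rewrite d5 in e5; rewrite d4 in e4; rewrite d3 in e3; rewrite d2 in e2.
clear line line0 geo kF gF d2 d3 d4 d5; glia.
Qed.

(** The bound [M] is chosen before [g]: if the conjugates by [p] of all [g ^+ i] with [i <= M] were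
    shorter than [100 * D + 100], two of them would agree, against torsion freeness. The conjugator
    [p] is a deep point on a geodesic from 1 to a long power of [g]. *)
Lemma exists_axial_power : finite_balls -> geodesic_length -> torsion_free K ->
  exists M, forall g, g != 1 ->
    exists j p, [/\ (0 < j)%N, (j <= M)%N & axial (p^-1 * g ^+ j * p)].
Proof.
move=> fin geo tf.
have [M hM] := ball_pigeonhole fin (100 * D + 99).
exists M => g g1.
(* The depth that [axial_of_deep_point] demands for [R = M * len g], which bounds the length of
   every [g ^+ j] with [j <= M]. *)
pose k := (3 * (M * len g) + 10 * D + 10)%N.
have [n hn] : exists n, (2 * k <= len (g ^+ n))%N.
  have [B hB] := ball_pigeonhole fin (2 * k).
  case: (boolP [exists i : 'I_B.+1, 2 * k < len (g ^+ i)]%N) => [/existsP[i hi]|/existsPn H].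
    by exists i; exact: ltnW.
  have [i hi|i [j [ij _]]] := hB (fun i => g ^+ i).
    by have := H (Ordinal (hi : (i < B.+1)%N)); rewrite -leqNgt.
  by move/(expg_inj_torsion_free tf g1) => e; rewrite e ltnn in ij.
have [|p [pk pF]] := geo (g ^+ n) k; first by glia.
have conjX i : (p^-1 * g * p) ^+ i = p^-1 * g ^+ i * p.
  by elim: i => [|i IH]; rewrite ?expg0 ?mulg1 ?mulVg // !expgS IH !mulgA mulgK.
have [j jM hj] : exists2 j, (j <= M)%N & (100 * D + 100 <= len (p^-1 * g ^+ j * p))%N.
  case: (boolP [exists i : 'I_M.+1, 100 * D + 100 <= len (p^-1 * g ^+ i * p)]%N)
    => [/existsP[i hi]|/existsPn H].
    by exists i => //; rewrite -ltnS.
  have [i hi|i [j [ij _]]] := hM (fun i => (p^-1 * g * p) ^+ i).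
    by have := H (Ordinal (hi : (i < M.+1)%N)); rewrite -ltnNge /= conjX; glia.
  have c1 : p^-1 * g * p != 1 by rewrite -mulgA -conjgE conjg_eq1.
  by move/(expg_inj_torsion_free tf c1) => e; rewrite e ltnn in ij.
exists j, p; split => //.
  by case: j hj {jM} => // hj; rewrite expg0 mulg1 mulVg len1 in hj; glia.
apply: (@axial_of_deep_point _ _ (g ^+ n) (M * len g)) => //.
- exact: commuteX2.
- by apply: leq_trans (lenX _ _) _; rewrite leq_mul2r jM orbT.
- by rewrite pk.
- by rewrite pk.
- by glia.
Qed.

(** * Shortest coset elements and the centralizer of an axial element *)

Lemma exists_shortest (P : K -> Prop) : (exists z, P z) ->
  exists2 z, P z & forall z', P z' -> (len z <= len z')%N.
Proof.
move=> [z0 Pz0].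
have ex : exists n, `[< exists2 z, P z & len z = n >].
  by exists (len z0); apply/asboolP; exists z0.
case: (ex_minnP ex) => n /asboolP[z Pz <-] hmin; exists z => // z' Pz'.
by apply: hmin; apply/asboolP; exists z'.
Qed.

(** The path to [z] cannot follow [g] for long, or [g^-1 * z] would be shorter than [z]; and the
    path to [g ^+ n] starts along [g]. *)
Lemma gp_axial_short (g z : K) n : axial g -> (len z <= len (g^-1 * z))%N ->
  (gp 1 (g ^+ n) z <= len g + D)%N.
Proof.
case: n => [|n] hg hz; first by rewrite expg0 gp11.
have := gpE 1 g z; rewrite !dist1 {1}/dist => e.
have := axial_gp_prefix 1 n hg; rewrite expg1 add1n => pre.
have := gp_hyp 1 g (g ^+ n.+1) z.
by case: hg => _ hg; glia.
Qed.

(** A shortest [z] in the coset of [g] leaves the axis of [h] almost at once. If [z] were long, a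
    path from [z] to [h ^+ n * z] would run back to the axis, along it and out again; but [z]
    commutes with [h], so this distance is exactly [len (h ^+ n)]. The product [h ^+ i * h ^- j]
    stands for an arbitrary integer power. *)
Lemma centralizer_axial_cobounded (h : K) : axial h ->
  exists C, forall g, commute g h -> exists i j, (len (h ^+ i * h ^- j * g) <= C)%N.
Proof.
move=> ah; exists (len h + 2 * D)%N => g gh.
have [|z [i [j ez]] zmin] := @exists_shortest (fun z => exists i j, z = h ^+ i * h ^- j * g).
  by exists g, 0%N, 0%N; rewrite expg0 mul1g invg1 mul1g.
exists i, j; rewrite -ez.
have zh n : (len z <= len (h ^+ n * z))%N.
  by apply: zmin; exists (n + i)%N, j; rewrite expgnDr ez !mulgA.
have zhV n : (len z <= len (h ^- n * z))%N.
  apply: zmin; exists i, (j + n)%N; rewrite ez !mulgA; congr (_ * _).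
  rewrite expgnDr invgM mulgA; congr (_ * _).
  by apply/commute_sym/commuteV/commuteX2.
have zc : commute z h.
  rewrite ez; apply/commute_sym/commuteM; last exact/commute_sym.
  by apply: commuteM; [exact: commuteX | apply/commuteV/commuteX].
set n := (len z + 10)%N.
have h1 : (gp 1 (h ^+ n) z <= len h + D)%N.
  by apply: gp_axial_short; rewrite // -(expg1 h) zhV.
have h2 : (gp 1 (h ^- n) z <= len h + D)%N.
  rewrite -expVgn -(lenV h); apply: gp_axial_short; first exact: axialV.
  by rewrite invgK -(expg1 h) zh.
have l := axial_lenX n ah.
have zn := zh n.
have e1 := gpE 1 (h ^- n) z; rewrite !dist1 lenV /dist invgK in e1.
have e2 := gpE 1 (h ^+ n) (h ^+ n * z); rewrite !dist1 {1}/dist mulKg in e2.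
have e3 := gpE 1 z (h ^+ n * z); rewrite !dist1 in e3.
have d3 : dist z (h ^+ n * z) = len (h ^+ n).
  by rewrite /dist mulgA -mulgA -(commuteX n zc) mulKg.
rewrite d3 in e3.
have hy := gp_hyp 1 (h ^+ n) (h ^+ n * z) z; rewrite (gpC 1 _ z) in hy.
have [_ lh] := ah.
have lz : (len z * 100 <= len z * len h)%N by rewrite leq_mul2l; glia.
have ln : (n * len h = len z * len h + 10 * len h)%N by rewrite /n mulnDl.
clearbody n; glia.
Qed.

(** * Ping-pong and free semigroups *)

Definition letter_word (l : bool -> K) (s : seq bool) : K := \prod_(b <- s) l b.

(* Counting positive words of a given length is enough for growth. *)
Definition free_pair (u v : K) : Prop := forall s t : seq bool, size s = size t ->
  letter_word (fun b => if b then u else v) s =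
  letter_word (fun b => if b then u else v) t -> s = t.

(** All corners of the broken path spelled by a positive word are controlled, so the path passes
    near its first letter. As [u] and [v] diverge at 1, equal words start with the same letter,
    which cancels. The bounds [ru] and [rv] are separate because in [ping_pong_far] the corner
    between [v^-1] and [v] is long. *)
Lemma ping_pong (u v : K) ru rv :
    (ru + D < len u)%N -> (rv + D < len v)%N ->
    (gp 1 u^-1 u <= ru)%N -> (gp 1 v^-1 v <= rv)%N ->
    (gp 1 u^-1 v <= minn ru rv)%N -> (gp 1 v^-1 u <= minn ru rv)%N ->
    (gp 1 u v <= minn ru rv)%N ->
  free_pair u v.
Proof.
move=> lu lv uu vv uv vu duv; rewrite /free_pair.
set l := fun b : bool => if b then u else v.
pose r b := if b then ru else rv.
have lr b : (r b + D < len (l b))%N by case: b.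
have lab a b : (gp 1 (l a)^-1 (l b) <= minn (r a) (r b))%N.
  by case: a b => -[]; rewrite /= ?minnn // minnC.
have al s b : along (letter_word l (b :: s)) (l b) (r b).
  elim: s b => [|a s IH] b; first by rewrite /letter_word big_seq1; exact: along_refl.
  by rewrite /letter_word big_cons; have [] := along_cons (IH a) (lr a) (lab b a).
elim=> [|a s IH] [|b t] // [st] e.
have eab : a = b.
  move: (al s a) (al t b); rewrite -e /along; case: a b {e} => -[] //= h1 h2.
  - by have := gp_hyp 1 u (letter_word l (true :: s)) v; rewrite (gpC 1 _ v); glia.
  - by have := gp_hyp 1 u (letter_word l (false :: s)) v; rewrite (gpC 1 _ v); glia.
subst b; congr (_ :: _); apply: IH => //.
by move: e; rewrite /letter_word !big_cons => /mulgI.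
Qed.

Lemma free_pair_conj (c u v : K) :
  free_pair (c * u * c^-1) (c * v * c^-1) -> free_pair u v.
Proof.
move=> H s t st e; apply: H => //.
have conjw (w : seq bool) : letter_word (fun b => if b then c * u * c^-1 else c * v * c^-1) w
    = c * letter_word (fun b => if b then u else v) w * c^-1.
  elim: w => [|b w IH]; first by rewrite /letter_word !big_nil mulg1 mulgV.
  rewrite /letter_word !big_cons; rewrite /letter_word in IH; rewrite IH.
  by case: b; rewrite !mulgA mulgVK.
by rewrite !conjw e.
Qed.

(* If the axes of [g1] and of [y g2 y^-1] fellow-travel for long, then
   [g1^i] and [y g2^i y^-1] displace a point of the overlap to within [24 D] of each
   other, for each [i <= M], so that two of the differences agree. *)
Lemma long_overlap (M : nat) (g1 g2 y : K) n :
    (forall f : nat -> K, (forall i, (i <= M)%N -> (len (f i) <= 24 * D)%N) ->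
      exists i j, [/\ (i < j)%N, (j <= M)%N & f i = f j]) ->
    axial g1 -> axial g2 -> (forall i, len (g1 ^+ i) = len (g2 ^+ i)) ->
    (len y <= 2 * len g1)%N -> (100 * (M + 10) <= n)%N ->
    ((4 * M + 12) * len g1 < gp 1 (g1 ^+ n) (y * g2 ^+ n))%N ->
  exists2 m, (0 < m)%N & y * g2 ^+ m * y^-1 = g1 ^+ m.
Proof.
move=> pigeon ag1 ag2 elen ly hn hP.
have [_ l1] := ag1.
have lin : (50 * (M * len g1) + 500 * len g1 <= len (g1 ^+ n))%N.
  have := axial_lenX n ag1.
  have : (100 * (M + 10) * len g1 <= n * len g1)%N by rewrite leq_mul2r hn orbT.
  by rewrite -mulnA mulnDl; glia.
have up j : (j <= 2 * M + 5)%N -> (len (g1 ^+ j) <= 2 * (M * len g1) + 5 * len g1)%N.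
  move=> hj; apply: leq_trans (lenX _ _) _.
  by rewrite mulnA -mulnDl leq_mul2r hj orbT.
have up' i : (i <= M)%N -> (len (g1 ^+ i) <= M * len g1)%N.
  by move=> hi; apply: leq_trans (lenX _ _) _; rewrite leq_mul2r hi orbT.
have hP' : (4 * (M * len g1) + 12 * len g1 < gp 1 (g1 ^+ n) (y * g2 ^+ n))%N.
  by rewrite mulnA -mulnDl.
set F := y * g2 ^+ n in hP hP'.
have near1 j : (j <= 2 * M + 5)%N -> (gp (g1 ^+ j) 1 F <= 10 * D)%N.
  move=> hj; have hjn : (j <= n)%N by glia.
  have := axial_gp_prefix j (n - j) ag1; rewrite subnKC // => pre.
  have := gp_flip 1 (g1 ^+ j) F; rewrite dist1.
  have := gp_hyp 1 (g1 ^+ j) (g1 ^+ n) F.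
  have := gp1_le (g1 ^+ j) F.
  have := up j hj; glia.
have [lo lo'] : (4 * len g1 <= len (g1 ^+ (M + 5)))%N /\
    (len (g1 ^+ (M + 5)) <= M * len g1 + 5 * len g1)%N.
  split; last by apply: leq_trans (lenX _ _) _; rewrite mulnDl.
  have := axial_lenD M 5 ag1.
  have [_ a1] := axial_cons 1 ag1; have [_ a2] := axial_cons 2 ag1.
  have [_ a3] := axial_cons 3 ag1; have [_ a4] := axial_cons 4 ag1.
  by rewrite expg1 in a1; glia.
have lok i : (4 * len g1 <= len (g1 ^+ (M + 5 + i)))%N.
  have := axial_lenD M (5 + i) ag1; rewrite addnA.
  have := axial_lenD 5 i ag1.
  have [_ a1] := axial_cons 1 ag1; have [_ a2] := axial_cons 2 ag1.
  have [_ a3] := axial_cons 3 ag1; have [_ a4] := axial_cons 4 ag1.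
  by rewrite expg1 in a1; glia.
have mlo i : (i <= M)%N -> (len (g1 ^+ i) + 4 * len g1 <= len (g1 ^+ (M + 5)))%N.
  move=> hi; have -> : (M + 5 = i + ((M - i) + 5))%N by glia.
  have := axial_lenD i (M - i + 5) ag1; have := axial_lenD (M - i) 5 ag1.
  have [_ a1] := axial_cons 1 ag1; have [_ a2] := axial_cons 2 ag1.
  have [_ a3] := axial_cons 3 ag1; have [_ a4] := axial_cons 4 ag1.
  by rewrite expg1 in a1; glia.
have near2 i : (i <= M)%N -> (gp (g1 ^+ (M + 5 + i)) y F <= 11 * D)%N.
  move=> hi; have hj : (M + 5 + i <= 2 * M + 5)%N by glia.
  have := near1 _ hj => h1.
  have := gp_far (g1 ^+ (M + 5 + i)) 1 y; rewrite (distC _ 1) !dist1 => h2.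
  have h3 := lok i.
  have : (gp (g1 ^+ (M + 5 + i)) y F <= 10 * D + D)%N.
    by apply: (@gp_shift _ _ _ 1) => //; rewrite gpC; glia.
  by glia.
(* Points on the axis of [g1], moved back by [y]. The offset [M + 5] keeps them far from both 1 and
   [y], compared with [len y], yet within the overlap. *)
pose z i := y^-1 * g1 ^+ (M + 5 + i).
have lz i : len (z i) = dist y (g1 ^+ (M + 5 + i)) by [].
have near3 i : (i <= M)%N -> (gp (z i) 1 (g2 ^+ n) <= 11 * D)%N.
  by move=> hi; have := near2 i hi; rewrite -(gpM y^-1) mulVg /F mulKg.
have e0 := addn0 (M + 5)%N.
have z0 := near3 0%N (leq0n _).
have lz0 := lz 0%N; rewrite e0 in lz0.
have lz0u : (len (z 0%N) <= len (g1 ^+ (M + 5)) + 2 * len g1)%N.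
  by have := lenM y^-1 (g1 ^+ (M + 5)); rewrite lenV /z e0; glia.
have lz0l : (len (g1 ^+ (M + 5)) <= len (z 0%N) + 2 * len g1)%N.
  by have := lenM y (z 0%N); rewrite /z mulVKg e0; glia.
(* Both points are near the geodesic from 1 to [g2 ^+ n], and their distances to 1 differ by at most
   [10 * D]. With the [13 * D] of [near4] and one [D] of hyperbolicity this gives [24 * D]. *)
have close i : (i <= M)%N -> (dist (z i) (g2 ^+ i * z 0%N) <= 24 * D)%N.
  move=> hi.
  have hin : (i <= n)%N by glia.
  have gi := elen i; have gn := elen n.
  have ui := up' i hi.
  have back : (gp 1 (g2 ^- i) (z 0%N) <= 10 * D)%N.
    have a := axial_gpX i n ag2.
    have b := gp_hyp 1 (g2 ^- i) (z 0%N) (g2 ^+ n).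
    have c := gp_flip 1 (z 0%N) (g2 ^+ n); rewrite dist1 in c.
    by glia.
  have q3a : (gp (z 0%N) 1 (g2 ^+ (n - i)) <= 12 * D)%N.
    have a := gp_far (z 0%N) (g2 ^+ n) (g2 ^+ (n - i)).
    have b : dist (g2 ^+ n) (g2 ^+ (n - i)) = len (g2 ^+ i).
      rewrite distC /dist -{2}(subnK hin) expgnDr mulKg //.
    have c := dist_triangle (z 0%N) 1 (g2 ^+ n); rewrite !dist1 in c.
    rewrite b in a.
    have : (gp (z 0%N) (g2 ^+ (n - i)) 1 <= 11 * D + D)%N.
      by apply: (@gp_shift _ _ _ (g2 ^+ n)); rewrite gpC //; glia.
    by rewrite gpC; glia.
  have q3 : (gp (z 0%N) (g2 ^- i) (g2 ^+ (n - i)) <= 13 * D)%N.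
    have a := gp_flip 1 (z 0%N) (g2 ^- i); rewrite dist1 (gpC 1) (gpC (z 0%N)) in a.
    have : (gp (z 0%N) (g2 ^- i) (g2 ^+ (n - i)) <= 12 * D + D)%N.
      by apply: (@gp_shift _ _ _ 1) => //; have := mlo i hi; glia.
    by glia.
  have near4 : (gp (g2 ^+ i * z 0%N) 1 (g2 ^+ n) <= 13 * D)%N.
    rewrite -(gpM (g2 ^- i)) mulKg mulg1.
    by rewrite -{1}(subnKC hin) expgnDr mulKg.
  have len4 := gpE 1 (g2 ^- i) (z 0%N); rewrite !dist1 lenV /dist invgK in len4.
  have q5 : (gp (g1 ^+ (M + 5)) y (g1 ^+ (M + 5 + i)) <= 10 * D)%N.
    have a := axial_gpX (M + 5) i ag1.
    have a' : (gp (g1 ^+ (M + 5)) 1 (g1 ^+ (M + 5 + i)) <= 9 * D)%N.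
      by rewrite -(gpM (g1 ^- (M + 5))) mulVg mulg1 (expgnDr g1 (M + 5)) mulKg.
    have b := gp_far (g1 ^+ (M + 5)) 1 y; rewrite (distC _ 1) !dist1 in b.
    have : (gp (g1 ^+ (M + 5)) y (g1 ^+ (M + 5 + i)) <= 9 * D + D)%N.
      by apply: (@gp_shift _ _ _ 1); rewrite // gpC; glia.
    by glia.
  have len5 := gpE (g1 ^+ (M + 5)) y (g1 ^+ (M + 5 + i)).
  have d5 : dist (g1 ^+ (M + 5)) (g1 ^+ (M + 5 + i)) = len (g1 ^+ i).
    by rewrite /dist (expgnDr g1 (M + 5)) mulKg.
  have lzi := lz i.
  rewrite d5 (distC _ y) -lz0 -lzi in len5.
  have n3 := near3 i hi.
  have f1 := gp_flip 1 (z i) (g2 ^+ n); rewrite dist1 in f1.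
  have f2 := gp_flip 1 (g2 ^+ i * z 0%N) (g2 ^+ n); rewrite dist1 in f2.
  have h := gp_hyp 1 (z i) (g2 ^+ n) (g2 ^+ i * z 0%N); rewrite (gpC 1 (g2 ^+ n)) in h.
  have e := gpE 1 (z i) (g2 ^+ i * z 0%N); rewrite !dist1 in e.
  clear near1 near2 near3 lok mlo up up' lz hP hP' pigeon elen; clearbody z; glia.
have [i hi|i [j [ij jM]]] := pigeon (fun i => (z i)^-1 * (g2 ^+ i * z 0%N)).
  exact: close.
have zE k : (z k)^-1 * (g2 ^+ k * z 0%N)
    = g1 ^- (M + 5) * (g1 ^- k * (y * g2 ^+ k * y^-1)) * g1 ^+ (M + 5).
  by rewrite /z addn0 addnC expgnDr !invgM !invgK !mulgA.
rewrite !zE => /mulIg/mulgI e.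
exists (j - i)%N; first by rewrite subn_gt0.
have h : g1 ^- j * g1 ^+ (j - i) = g1 ^- i.
  by rewrite -{1}(subnK (ltnW ij)) expgnDr invgM mulgVK.
have {}e : g1 ^+ (j - i) * y * g2 ^+ i = y * g2 ^+ (j - i) * g2 ^+ i.
  rewrite -(mulgA y) -expgnDr (subnK (ltnW ij)).
  apply: (mulgI (g1 ^- j)); apply: (mulIg y^-1).
  by rewrite -!mulgA in e *; rewrite mulgA h e.
by move/mulIg: e => <-; rewrite mulgK.
Qed.

(* The base point 1 is then close to both axes. *)
Lemma ping_pong_near (M : nat) (g y : K) n :
    axial g -> (len y <= 2 * len g)%N -> (100 * (M + 10) <= n)%N ->
    (forall g1 g2, (g1 = g \/ g1 = g^-1) -> (g2 = g \/ g2 = g^-1) ->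
      (gp 1 (g1 ^+ n) (y * g2 ^+ n) <= (4 * M + 12) * len g1)%N) ->
  free_pair (g ^+ n) (y * g ^+ n * y^-1).
Proof.
move=> ag ly hn H.
have lin : (50 * (M * len g) + 500 * len g <= len (g ^+ n))%N.
  have := axial_lenX n ag.
  have : (100 * (M + 10) * len g <= n * len g)%N by rewrite leq_mul2r hn orbT.
  by rewrite -mulnA mulnDl; glia.
have [_ l1] := ag.
set v := y * g ^+ n * y^-1.
have gpv (x w : K) : (gp 1 x (y * w * y^-1) <= gp 1 x (y * w) + 4 * len g)%N.
  have := gp_rD (y * w) 1 (y * w * y^-1) x.
  by rewrite (distC _ (y * w)) /dist mulKg lenV; glia.
have vV : v^-1 = y * g^-1 ^+ n * y^-1 by rewrite /v !invgM !invgK expVgn mulgA.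
have gpuv g1 g2 : (g1 = g \/ g1 = g^-1) -> (g2 = g \/ g2 = g^-1) ->
    (gp 1 (g1 ^+ n) (y * g2 ^+ n * y^-1) <= 4 * (M * len g) + 16 * len g)%N.
  move=> h1 h2; have := H g1 g2 h1 h2; have := gpv (g1 ^+ n) (g2 ^+ n).
  have -> : len g1 = len g by case: h1 => ->; rewrite ?lenV.
  by rewrite mulnDl -mulnA; glia.
have lv : (len (g ^+ n) <= len v + 4 * len g)%N.
  have := lenM y^-1 (v * y); have := lenM v y; rewrite /v mulgVK mulKg lenV; glia.
pose r := (4 * (M * len g) + 20 * len g)%N.
have uu := axial_gpX n n ag.
apply: (@ping_pong _ _ r r); rewrite ?minnn /r; try glia.
- rewrite vV gpC /v.
  have a := gpv (y * g ^+ n * y^-1) (g^-1 ^+ n).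
  rewrite (gpC 1 (y * g ^+ n * y^-1) (y * g^-1 ^+ n)) in a.
  have b := gpv (y * g^-1 ^+ n) (g ^+ n).
  have c := gp_baseD y 1 (y * g^-1 ^+ n) (y * g ^+ n).
  have d : gp y (y * g^-1 ^+ n) (y * g ^+ n) = gp 1 (g ^- n) (g ^+ n).
    by rewrite -{1}(mulg1 y) gpM expVgn.
  by rewrite d dist1 in c; glia.
- rewrite -expVgn; have := gpuv g^-1 g (or_intror erefl) (or_introl erefl).
  by rewrite -/v; glia.
- by rewrite vV gpC; have := gpuv g g^-1 (or_introl erefl) (or_intror erefl); glia.
- by have := gpuv g g (or_introl erefl) (or_introl erefl); rewrite -/v; glia.
Qed.

(* [y] is a shortest bridge between the axes of [g] and [y g y^-1], and all the
   corners of the broken geodesics in the letters [g^n], [y] are controlled. *)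
Lemma ping_pong_far (g y : K) n :
    axial g -> (10 <= n)%N ->
    (forall a b : K, commute a g -> commute b g -> len y <= len (a * y * b))%N ->
    (len g + 2 * D < len y)%N ->
  free_pair (g ^+ n) (y * g ^+ n * y^-1).
Proof.
move=> ag hn ymin ly.
have [_ l1] := ag.
have lin : (5 * len g <= len (g ^+ n))%N.
  have := axial_lenX n ag.
  have : (10 * len g <= n * len g)%N by rewrite leq_mul2r hn orbT.
  by glia.
pose C := (len g + D)%N.
have cgV : commute g^-1 g by apply/commute_sym/commuteV.
(* By minimality, left multiplication by [g] or [g^-1] shortens neither [y] nor [y^-1], which is
   what [gp_axial_short] requires. *)
have corner g1 m : g1 = g \/ g1 = g^-1 ->
    ((gp 1 (g1 ^+ m) y <= C)%N * (gp 1 (g1 ^+ m) y^-1 <= C)%N)%type.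
  move=> h1; have ag1 : axial g1 by case: h1 => -> //; exact: axialV.
  have c1 : commute g1 g by case: h1 => ->.
  have c1V : commute g1^-1 g by apply/commute_sym/commuteV/commute_sym.
  have c11 : commute 1 g by exact/commute_sym/commute1.
  have -> : C = (len g1 + D)%N by case: h1 => ->; rewrite ?lenV.
  split; apply: gp_axial_short => //.
    by rewrite -[g1^-1 * y]mulg1 ymin.
  rewrite (lenV y) -(lenV (g1^-1 * y^-1)) invgM !invgK -[y * g1](mul1g) mulgA.
  by rewrite ymin.
have Dy : (C + D < len y)%N by rewrite /C; glia.
have spoke g1 m : g1 = g \/ g1 = g^-1 -> (5 * len g <= len (g1 ^+ m))%N ->
    along (y * g1 ^+ m * y^-1) y C /\
    (2 * len y + len (g1 ^+ m) <= len (y * g1 ^+ m * y^-1) + 2 * C + 2 * D)%N.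
  move=> h1 lm.
  have h1V : g1^-1 = g \/ g1^-1 = g^-1 by case: h1 => ->; rewrite ?invgK; [right|left].
  have Dg : (C + D < len (g1 ^+ m))%N by rewrite /C; glia.
  have DyV : (C + D < len y^-1)%N by rewrite lenV.
  have h : (gp 1 (g1 ^+ m)^-1 y^-1 <= minn C C)%N by rewrite minnn -expVgn corner.
  have [_ a2 a3] := along_cons (along_refl y^-1 C) DyV h.
  have h' : (gp 1 y^-1 (g1 ^+ m) <= minn C C)%N by rewrite minnn gpC corner.
  have [_ b2 b3] := along_cons a2 Dg h'.
  by rewrite -mulgA; split => //; rewrite lenV in a3; glia.
have spoke2 g1 g2 : g1 = g \/ g1 = g^-1 -> g2 = g \/ g2 = g^-1 ->
    (gp 1 (g1 ^+ n) (y * g2 ^+ n * y^-1) <= C + D)%N.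
  move=> h1 h2.
  have h1V : g1^-1 = g \/ g1^-1 = g^-1 by case: h1 => ->; rewrite ?invgK; [right|left].
  have [|al _] := spoke g2 n h2; first by case: h2 => ->; rewrite ?expVgn ?lenV.
  have h : (gp 1 (g1^-1 ^+ n)^-1 y <= minn C C)%N.
    by rewrite minnn expVgn invgK corner.
  by have [+ _ _] := along_cons al Dy h; rewrite minnn expVgn invgK.
set v := y * g ^+ n * y^-1.
have vV : v^-1 = y * g^-1 ^+ n * y^-1 by rewrite /v !invgM !invgK expVgn mulgA.
have [_ lv] := spoke g n (or_introl erefl) lin; rewrite -/v in lv.
have n2 := axial_lenD n n ag.
have [|_ lv2] := spoke g (n + n)%N (or_introl erefl); first by glia.
have v2 : y * g ^+ (n + n) * y^-1 = v * v by rewrite /v expgnDr !mulgA mulgVK.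
have vv := gpE 1 v^-1 v; rewrite !dist1 lenV /dist invgK -v2 in vv.
have lv' : (len v <= 2 * len y + len (g ^+ n))%N.
  have := lenM (y * g ^+ n) y^-1; have := lenM y (g ^+ n); rewrite lenV -/v; glia.
(* The paths to [v] and [v^-1] both start along [y], so this corner is long. Comparing the lengths
   of [v] and [v * v] bounds it by [rv], which the middle part [g ^+ n] keeps below [len v]. *)
pose rv := (2 * len y + 9 * D + 2 * C + 2 * D)%N.
have uu := axial_gpX n n ag.
have hC : C = (len g + D)%N by [].
have mn : minn (C + D) rv = (C + D)%N by apply/minn_idPl; rewrite /rv; lia.
have lu : (C + D + D < len (g ^+ n))%N by lia.
have lrv : (rv + D < len v)%N by rewrite /rv; lia.
have uu' : (gp 1 (g ^- n) (g ^+ n) <= C + D)%N by lia.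
have vv' : (gp 1 v^-1 v <= rv)%N.
  by rewrite v2 in vv lv2; have := v2; rewrite /rv; glia.
apply: (ping_pong lu lrv uu' vv'); rewrite mn.
- by rewrite -expVgn; exact: spoke2 (or_intror erefl) (or_introl erefl).
- by rewrite vV gpC; exact: spoke2 (or_introl erefl) (or_intror erefl).
- exact: spoke2 (or_introl erefl) (or_introl erefl).
Qed.

(** Multiplying [y] on both sides by elements commuting with [g] only conjugates the pair, so [y]
    may be replaced by a shortest element [z] of its double coset. If [z] is long, the axes are far
    apart; otherwise an overlap of many periods would give one of the excluded conjugacy relations.
    The exponent depends only on the pigeonhole bound [M]. *)
Lemma uniform_ping_pong : finite_balls -> exists2 n, (0 < n)%N &
  forall g y : K, axial g ->
    (forall m, (0 < m)%N -> y * g ^+ m * y^-1 <> g ^+ m) ->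
    (forall m, (0 < m)%N -> y * g ^+ m * y^-1 <> g ^- m) ->
  free_pair (g ^+ n) (y * g ^+ n * y^-1).
Proof.
move=> fin; have [M hM] := ball_pigeonhole fin (24 * D).
exists (100 * (M + 10))%N => [|g y ag hp hm]; first by glia.
set n := (100 * (M + 10))%N.
have [|z [a [b [ag' bg ez]]] zmin] := @exists_shortest
    (fun z => exists a b, [/\ commute a g, commute b g & z = a * y * b]).
  by exists y, 1, 1; rewrite mul1g mulg1; split => //; exact/commute_sym/commute1.
have conjz m : z * g ^+ m * z^-1 = a * (y * g ^+ m * y^-1) * a^-1.
  rewrite ez !invgM !mulgA; congr (_ * _ * _); rewrite -!mulgA; congr (_ * (_ * _)).
  by rewrite mulgA (commuteX m bg) -mulgA mulgV mulg1.
have conja m : a * g ^+ m * a^-1 = g ^+ m by rewrite (commuteX m ag') mulgK.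
have zp m : (0 < m)%N -> z * g ^+ m * z^-1 <> g ^+ m.
  by move=> m0; rewrite conjz -{2}(conja m) => /mulIg/mulgI; exact: hp.
have zm m : (0 < m)%N -> z * g ^+ m * z^-1 <> g ^- m.
  move=> m0; rewrite conjz => e; apply: (hm m m0).
  have : a * g ^- m * a^-1 = g ^- m.
    by rewrite -{2}(conja m) !invgM invgK mulgA.
  by move=> h; move: e; rewrite -{1}h => /mulIg/mulgI.
suff Hz : free_pair (g ^+ n) (z * g ^+ n * z^-1).
  by apply: (@free_pair_conj a); rewrite conja -conjz.
have [ly|ly] := leqP (len z) (len g + 2 * D); last first.
  apply: ping_pong_far => //; first by rewrite /n; glia.
  move=> c d cg dg; apply: zmin; exists (c * a), (b * d); split.
  - exact/commute_sym/commuteM/commute_sym/ag'/commute_sym.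
  - exact/commute_sym/commuteM/commute_sym/dg/commute_sym.
  - by rewrite ez !mulgA.
have [_ l1] := ag.
apply: (@ping_pong_near M) => //; first by glia.
move=> g1 g2 h1 h2; rewrite leqNgt; apply/negP => hP.
have ax g0 : g0 = g \/ g0 = g^-1 -> axial g0 by case=> -> //; exact: axialV.
have ll g0 i : g0 = g \/ g0 = g^-1 -> len (g0 ^+ i) = len (g ^+ i).
  by case=> ->; rewrite ?expVgn ?lenV.
have lg1 := ll g1 1%N h1; rewrite !expg1 in lg1.
have hn : (100 * (M + 10) <= n)%N by [].
have lz : (len z <= 2 * len g1)%N by rewrite lg1; glia.
have ll12 i : len (g1 ^+ i) = len (g2 ^+ i) by rewrite !ll.
have [m m0] := long_overlap hM (ax g1 h1) (ax g2 h2) ll12 lz hn hP.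
have cV : z * g^-1 ^+ m * z^-1 = (z * g ^+ m * z^-1)^-1.
  by rewrite !invgM !invgK expVgn mulgA.
case: h1 h2 => -> [] ->.
- exact: zp.
- by rewrite cV => e; apply: (zm m m0); apply: invg_inj; rewrite e invgK.
- by move=> e; exact: (zm m m0 (etrans e (expVgn g m))).
- by rewrite cV => e; apply: (zp m m0); apply: invg_inj; exact: (etrans e (expVgn g m)).
Qed.

End GromovProduct.

(** * Integer powers and transfer *)

Section IntegerPowerTheory.
Variable G : groupType.
Implicit Types (x y : G) (m n : int).

Lemma expgz_nat x (n : nat) : expgz x n = x ^+ n.
Proof. exact: iter_mulg_1. Qed.

Lemma expgzN x n : expgz x (- n)%R = (expgz x n)^-1.
Proof. by apply: (mulIg (expgz x n)); rewrite -expgzD addNr mulVg. Qed.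

Lemma expgz_natN x (n : nat) : expgz x (- n%:Z)%R = x ^- n.
Proof. by rewrite expgzN expgz_nat. Qed.

Lemma expgz1n n : expgz (1 : G) n = 1.
Proof. by case: (intP n) => [//|k|k]; rewrite ?expgz_natN ?expgz_nat expg1n ?invg1. Qed.

Lemma expgz_conj y x n : expgz (y * x * y^-1) n = y * expgz x n * y^-1.
Proof.
have H (k : nat) : (y * x * y^-1) ^+ k = y * x ^+ k * y^-1.
  by elim: k => [|k IH]; rewrite ?expg0 ?mulg1 ?mulgV // !expgS IH !mulgA mulgVK.
case: (intP n) => [|k|k]; rewrite ?expgz_nat ?expgz_natN ?H //.
by rewrite !invgM invgK mulgA.
Qed.

Lemma expgzM x m n : expgz x (m * n)%R = expgz (expgz x m) n.
Proof.
elim/int_ind: n => [|n IH|n IH]; first by rewrite mulr0.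
  by rewrite Posz_succ mulrDr mulr1 !expgzD IH expgz1.
by rewrite Posz_oppS mulrDr mulrN1 !expgzD IH !expgzN expgz1.
Qed.

Lemma commute_expgz x y n : commute x y -> commute x (expgz y n).
Proof.
move=> xy; case: (intP n) => [|k|k]; rewrite ?expgz_nat ?expgz_natN.
- exact: commute1.
- exact: commuteX.
- exact/commuteV/commuteX.
Qed.

Lemma expgz_inj x : torsion_free G -> x != 1 -> injective (expgz x).
Proof.
move=> tf x1; have H (n : int) : expgz x n = 1 -> n = 0%R.
  case: (intP n) => [//|k|k]; rewrite ?expgz_nat ?expgz_natN => e.
    by case/eqP: x1; apply: tf e.
  by case/eqP: x1; apply: (tf _ k.+1) => //; apply: invg_inj; rewrite e invg1.
move=> m n e; apply/eqP; rewrite -subr_eq0; apply/eqP/H.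
by rewrite expgzD expgzN e mulgV.
Qed.

End IntegerPowerTheory.

Lemma int_subgroup_cyclic (P : int -> Prop) : P 0%R ->
    (forall m n, P m -> P n -> P (m - n)%R) ->
  exists2 d : int, P d & forall n, P n -> exists k, n = (k * d)%R.
Proof.
move=> P0 PB.
have PN m : P m -> P (- m)%R by move=> Pm; rewrite -sub0r; exact: PB.
have PD m n : P m -> P n -> P (m + n)%R.
  by move=> Pm Pn; rewrite -(opprK n); apply: PB => //; exact: PN.
have PM m (k : int) : P m -> P (k * m)%R.
  move=> Pm; elim/int_ind: k => [|k IH|k IH]; first by rewrite mul0r.
    by rewrite Posz_succ mulrDl mul1r; exact: PD.
  by rewrite Posz_oppS mulrBl mul1r; exact: PB.
case: (pselect (exists n : nat, (0 < n)%N && `[< P (Posz n) >])) => [ex|nex]; last first.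
  exists 0%R => // n Pn; exists 0%R; rewrite mul0r.
  apply: contrapT => /eqP n0; apply: nex; exists `|n|%N; rewrite absz_gt0 n0 /=.
  by apply/asboolP; case: (intP n) n0 Pn => //= k _ /PN; rewrite opprK.
case: (ex_minnP ex) => d /andP[d0 /asboolP Pd] dmin; exists (Posz d) => // n Pn.
exists (n %/ d)%Z; have := divz_eq n d => {1}->.
have d0' : (d%:Z != 0)%R by rewrite eqz_nat -lt0n.
have [r er] : exists r : nat, (n %% d)%Z = r.
  by exists `|(n %% d)%Z|%N; rewrite gez0_abs // modz_ge0.
have Pr : P r.
  suff -> : Posz r = (n - (n %/ d)%Z * d)%R by apply: PB => //; exact: PM.
  by apply/eqP; rewrite eq_sym subr_eq addrC -er -divz_eq.
have rd : (r < d)%N by have := ltz_mod n d0'; rewrite er; lia.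
rewrite er; case: r {er} Pr rd => [|r] Pr rd; first by rewrite addr0.
by have := dmin r.+1; rewrite /= asboolT // => /(_ isT); rewrite leqNgt rd.
Qed.

(** * Transfer of a centralizer into a cyclic subgroup of finite index *)

Section Transfer.
Variables (G : groupType) (x : G) (Q : seq G).
Hypotheses (tf : torsion_free G) (x1 : x != 1).
Hypothesis cosets : forall g, commute g x -> exists e : int, expgz x e * g \in Q.

Let same_coset (g q : G) : bool := `[< exists e : int, q = expgz x e * g >].

(** A canonical representative: the first element of [Q] in the coset of [g]. The list [Q] may meet
    a coset several times; the default 1 is not reached when [g] commutes with [x]. *)
Let rep (g : G) : G := nth 1 Q (find (same_coset g) Q).

Let has_rep g : commute g x -> has (same_coset g) Q.
Proof.
by move=> /cosets[e he]; apply/hasP; exists (expgz x e * g) => //; apply/asboolP; exists e.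
Qed.

Let rep_coset g : commute g x -> exists e : int, rep g = expgz x e * g.
Proof. by move=> /has_rep/(nth_find 1)/asboolP. Qed.

Let rep_shift g (e : int) : rep (expgz x e * g) = rep g.
Proof.
rewrite /rep; congr (nth 1 Q _); apply: eq_find => q; apply/asbool_equiv_eq.
split=> -[f ->]; first by exists (f + e)%R; rewrite expgzD mulgA.
by exists (f - e)%R; rewrite expgzD expgzN mulgA mulgVK.
Qed.

Let shift (g : G) : int := xget 0%R [set e : int | rep g = expgz x e * g].

Let shiftE g : commute g x -> rep g = expgz x (shift g) * g.
Proof.
move=> /rep_coset[e he].
exact: (@xgetPex _ 0%R [set e : int | rep g = expgz x e * g] (ex_intro _ e he)).
Qed.

Let reps : seq G := undup [seq q <- Q | `[< commute q x >] & rep q == q].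

Let mem_reps q : q \in reps -> commute q x /\ rep q = q.
Proof. by rewrite mem_undup mem_filter => /andP[/andP[/asboolP ? /eqP ?] _]. Qed.

Let rep_mem g : commute g x -> rep g \in reps.
Proof.
move=> gx; have [e he] := rep_coset gx.
rewrite mem_undup mem_filter (mem_nth 1) -?has_find ?has_rep // andbT.
apply/andP; split; last by rewrite he rep_shift -he.
apply/asboolP; rewrite he; apply/commute_sym/commuteM; last exact/commute_sym.
exact: commute_expgz.
Qed.

Let commM g h : commute g x -> commute h x -> commute (g * h) x.
Proof. by move=> /commute_sym gx /commute_sym hx; exact/commute_sym/commuteM. Qed.

(** The transfer homomorphism in additive form, up to sign: it sends [x] to minus the index of the
    subgroup generated by [x] in its centralizer. *)
Definition transfer (g : G) : int := (\sum_(q <- reps) shift (q * g))%R.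

Let shiftM q g h : commute q x -> commute g x -> commute h x ->
  shift (q * g * h) = (shift (q * g) + shift (rep (q * g) * h))%R.
Proof.
move=> qx gx hx; have qgx := commM qx gx.
apply: (expgz_inj tf x1); apply: (mulIg (q * g * h)).
rewrite -shiftE; last exact: commM.
rewrite addrC expgzD -(mulgA (expgz x (shift (rep _ * h)))).
rewrite (mulgA (expgz x (shift (q * g)))) -shiftE //.
have rx : commute (rep (q * g)) x by have [] := mem_reps (rep_mem qgx).
rewrite -shiftE; last exact: commM.
by rewrite (shiftE qgx) -(mulgA (expgz x _)) rep_shift.
Qed.

(** Sending [q] to [rep (q * g)] permutes the representatives; after this reindexing the cocycle
    identity [shiftM] sums to additivity. *)
Lemma transferM g h : commute g x -> commute h x ->
  transfer (g * h) = (transfer g + transfer h)%R.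
Proof.
move=> gx hx; pose f q := rep (q * g).
have fx q : q \in reps -> commute (q * g) x by move=> /mem_reps[qx _]; exact: commM.
have f_inj : {in reps &, injective f}.
  move=> q q' qr qr'; rewrite /f (shiftE (fx _ qr)) (shiftE (fx _ qr')) !mulgA => /mulIg e.
  have [_ <-] := mem_reps qr; have [_ <-] := mem_reps qr'.
  by rewrite -(rep_shift q (shift (q * g))) e rep_shift.
have uf : uniq (map f reps) by rewrite map_inj_in_uniq // undup_uniq.
have sub : {subset map f reps <= reps} by move=> _ /mapP[q qr ->]; exact/rep_mem/fx.
have [_ ef] := uniq_min_size uf sub (eq_leq (esym (size_map f reps))).
have pf : perm_eq (map f reps) reps by apply: uniq_perm; rewrite ?undup_uniq.
rewrite /transfer -[in X in (_ + X)%R](perm_big _ pf) /= big_map -big_split /=.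
rewrite big_seq_cond [RHS]big_seq_cond; apply: eq_bigr => q; rewrite andbT => qr.
by rewrite mulgA shiftM //; have [] := mem_reps qr.
Qed.

Lemma transfer_expgz g (n : int) : commute g x -> transfer (expgz g n) = (n * transfer g)%R.
Proof.
move=> gx; have cgn m : commute (expgz g m) x by apply/commute_sym/commute_expgz/commute_sym.
have t0 : transfer 1 = 0%R.
  have c1 : commute 1 x by exact/commute_sym/commute1.
  by apply: (addrI (transfer 1)); rewrite -transferM // mulg1 addr0.
elim/int_ind: n => [|n IH|n IH]; first by rewrite mul0r.
  by rewrite Posz_succ expgzD expgz1 transferM // IH mulrDl mul1r.
apply: (addIr (transfer g)); rewrite -transferM // Posz_oppS -{2}(expgz1 g) -expgzD subrK IH.
by rewrite mulrBl mul1r subrK.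
Qed.

(** By pigeonhole on the cosets, some positive power of [g] is [expgz x b]. Its transfer is 0 and
    also [b] times the nonzero transfer of [x], so [b = 0] and torsion freeness applies. *)
Lemma transfer_eq0 g : commute g x -> transfer g = 0%R -> g = 1.
Proof.
move=> gx tg0.
have cg n : commute (g ^+ n) x by apply/commute_sym/commuteX/commute_sym.
have c1 : commute 1 x by exact/commute_sym/commute1.
have [i [j [ij e]]] : exists i j, (i < j)%N /\ rep (g ^+ i) = rep (g ^+ j).
  apply: contrapT => H.
  have inj : {in iota 0 (size Q).+1 &, injective (fun i => rep (g ^+ i))}.
    move=> i j _ _ e; apply: contrapT => /eqP; rewrite neq_ltn => /orP[] ij; apply: H.
      by exists i, j.
    by exists j, i.
  pose l := map (fun i => rep (g ^+ i)) (iota 0 (size Q).+1).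
  have ul : uniq l by rewrite map_inj_in_uniq ?iota_uniq.
  have lQ : {subset l <= Q} by move=> _ /mapP[i _ ->]; rewrite mem_nth // -has_find has_rep.
  by have := uniq_leq_size ul lQ; rewrite size_map size_iota ltnn.
have [b eb] : exists b : int, g ^+ (j - i) = expgz x b.
  rewrite !shiftE // in e; exists (shift (g ^+ i) - shift (g ^+ j))%R.
  apply: (mulIg (g ^+ i)); rewrite -expgnDr subnK ?(ltnW ij) //.
  by rewrite addrC expgzD expgzN -mulgA e mulKg.
have tx : transfer x = (- (size reps)%:Z)%R.
  rewrite /transfer (eq_big_seq (fun _ => (-1)%R)); last first.
    move=> q /mem_reps[qx qr]; have qxx : commute (q * x) x by exact: commM.
    apply: (expgz_inj tf x1); apply: (mulIg (q * x)); rewrite -shiftE //.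
    have -> : q * x = expgz x 1%R * q by rewrite expgz1.
    by rewrite rep_shift qr expgzN mulKg.
  rewrite big_const_seq count_predT iter_addr_0 mulNrn.
  by rewrite -[(1 *+ _)%R]/((size reps)%:R%R) natz.
have b0 : b = 0%R.
  have := transfer_expgz b (commute_refl x).
  rewrite -eb -expgz_nat transfer_expgz // tg0 mulr0 tx.
  have : (0 < size reps)%N by case: reps (rep_mem c1).
  move=> s0 /esym/eqP; rewrite mulf_eq0 oppr_eq0 eqz_nat => /orP[/eqP//|].
  by case: (size _) s0.
by apply: (tf (n := (j - i)%N)); rewrite ?subn_gt0 // eb b0.
Qed.

End Transfer.

(** * Torsion free groups whose nontrivial cyclic subgroups have finite index in the centralizers of
    their generators *)

Definition cocyclic_centralizers (G : groupType) : Prop :=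
  forall x : G, x != 1 -> exists Q : seq G,
    forall g, commute g x -> exists e : int, expgz x e * g \in Q.

Section Centralizers.
Variable G : groupType.
Hypotheses (tf : torsion_free G) (cc : cocyclic_centralizers G).

Lemma centralizer_embeds (x : G) : x != 1 -> exists V : G -> int,
  [/\ forall g h, commute g x -> commute h x -> V (g * h) = (V g + V h)%R,
      forall g n, commute g x -> V (expgz g n) = (n * V g)%R &
      forall g h, commute g x -> commute h x -> V g = V h -> g = h].
Proof.
move=> x1; have [Q hQ] := cc x1; exists (transfer x Q).
have tM := transferM tf x1 hQ; have tX := transfer_expgz tf x1 hQ.
split=> // g h gx hx e.
have hVx : commute h^-1 x by apply/commute_sym/commuteV/commute_sym.
apply/eqP; rewrite -divg_eq1; apply/eqP.
apply: (transfer_eq0 tf x1 hQ); first exact/commute_sym/commuteM/commute_sym/hVx/commute_sym.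
have := tX h (-1)%R hx; rewrite expgzN expgz1 => tV.
by rewrite tM // tV e mulN1r subrr.
Qed.

(** The centralizer of [x] embeds in the integers, hence is abelian. *)
Lemma commute_trans (x g h : G) : x != 1 -> commute g x -> commute h x -> commute g h.
Proof.
move=> x1 gx hx; have [V [VM _ Vinj]] := centralizer_embeds x1.
have cM a b : commute a x -> commute b x -> commute (a * b) x.
  by move=> /commute_sym ax /commute_sym bx; exact/commute_sym/commuteM.
by apply: Vinj; rewrite ?VM 1?addrC //; exact: cM.
Qed.

Lemma abelian_subgroup_cyclic (P : set G) (x : G) : is_subgroup P -> x != 1 ->
    (forall g, P g -> commute g x) ->
  exists2 d, P d & forall g, P g -> exists n : int, g = expgz d n.
Proof.
move=> [P1 PD] x1 Px; have [V [VM VX Vinj]] := centralizer_embeds x1.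
have [||_ [d Pd <-] dgen] := @int_subgroup_cyclic (V @` P).
- exists 1 => //; have c1 : commute 1 x by exact/commute_sym/commute1.
  by apply: (addrI (V 1)); rewrite -VM // mulg1 addr0.
- move=> _ _ [g Pg <-] [h Ph <-]; exists (g / h); first exact: PD.
  have hV : commute h^-1 x by apply/commute_sym/commuteV/commute_sym/Px.
  have := VX h (-1)%R (Px h Ph); rewrite expgzN expgz1 mulN1r => <-.
  by rewrite VM //; exact: Px.
exists d => // g Pg; have [|n en] := dgen (V g); first by exists g.
exists n; apply: Vinj; first exact: Px.
- exact/commute_sym/commute_expgz/commute_sym/Px.
- by rewrite en VX //; exact: Px.
Qed.

Lemma int_mul_eq1 (m n : int) : (m * n = 1)%R -> m = 1%R \/ m = (-1)%R.
Proof.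
move=> e; have : (`|m| * `|n| = 1)%N by rewrite -abszM e.
by move/eqP; rewrite muln_eq1 => /andP[/eqP m1 _]; lia.
Qed.

(** The centralizer of [c] is cyclic, generated by some [d], and [g] normalizes it by
    [commute_trans], so [g] conjugates [d] to [d] or [d^-1]. In the second case, if [g] is not 1,
    then [g ^+ 2] is nontrivial and commutes with both [g] and [d], which therefore commute. *)
Lemma commute_of_conj (g c : G) : c != 1 -> commute (g * c * g^-1) c -> commute g c.
Proof.
move=> c1 gc.
have conj1 (h b : G) : b != 1 -> h * b * h^-1 != 1.
  by move=> b1; rewrite -{1}(invgK h) -mulgA -conjgE conjg_eq1.
have conjc (h a b : G) : commute a b -> commute (h * a * h^-1) (h * b * h^-1).
  by rewrite /commute => e; rewrite !mulgA !mulgVK -!(mulgA h) -!mulgA !(mulgA _ _ h^-1) e.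
have gc' : commute (g^-1 * c * g) c.
  have := conjc g^-1 _ _ gc; rewrite invgK !mulgA mulVg mul1g mulgVK => /commute_sym.
  by [].
have cdiv : is_subgroup [set h | commute h c].
  split; first exact/commute_sym/commute1.
  by move=> x y /= /commute_sym xc /commute_sym yc; exact/commute_sym/commuteM/commuteV.
have [d dc dgen] := abelian_subgroup_cyclic cdiv c1 (fun h => id).
have d1 : d != 1.
  apply: contra c1 => /eqP ed; have [n ->] := dgen c (commute_refl c).
  by rewrite ed expgz1n.
have stable h : commute (h * c * h^-1) c -> exists n, h * d * h^-1 = expgz d n.
  move=> hc; apply: dgen; apply: (commute_trans (conj1 h c c1)); first exact: conjc.
  exact: commute_sym.
have [m em] := stable g gc.
have [n en] : exists n, g^-1 * d * g = expgz d n.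
  by have := stable g^-1; rewrite invgK; apply.
have : (m * n = 1)%R.
  apply: (expgz_inj tf d1); rewrite expgzM -em expgz_conj -en expgz1.
  by rewrite !mulgA mulgV mul1g mulgK.
case/int_mul_eq1 => em1; rewrite em1 ?expgzN expgz1 in em.
  have gd : commute g d by rewrite /commute -{2}em mulgVK.
  by apply: (commute_trans d1) => //; exact: commute_sym.
have [->|g1] := eqVneq g 1; first exact/commute_sym/commute1.
have g21 : g ^+ 2 != 1 by apply: contra g1 => /eqP e; apply/eqP; exact: (tf (n := 2)).
have g2d : commute d (g ^+ 2).
  apply: commute_sym; rewrite /commute expg2 -mulgA.
  have gd : g * d = d^-1 * g by rewrite -em mulgVK.
  have gdV : g * d^-1 = d * g.
    by apply: (mulgI d^-1); rewrite mulKg mulgA -gd mulgK.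
  by rewrite gd mulgA gdV mulgA.
have gd : commute g d.
  by apply: (commute_trans g21) => //; rewrite expg2; apply: commuteM.
by apply: (commute_trans d1) => //; exact: commute_sym.
Qed.

End Centralizers.

(** * Subgroups of extensions by Z *)

Section Words.
Variable G : groupType.

Lemma subgroupV (S : set G) (x : G) : is_subgroup S -> S x -> S x^-1.
Proof. by move=> [S1 SD] Sx; rewrite -div1g; exact: SD. Qed.

Lemma subgroupM (S : set G) (x y : G) : is_subgroup S -> S x -> S y -> S (x * y).
Proof. by move=> hS Sx Sy; rewrite -(invgK y); apply: hS.2 => //; exact: subgroupV. Qed.

Lemma subgroup_expgz (S : set G) (x : G) (n : int) : is_subgroup S -> S x -> S (expgz x n).
Proof.
move=> hS Sx; elim/int_ind: n => [|n IH|n IH]; first exact: hS.1.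
  by rewrite Posz_succ expgzD expgz1; exact: subgroupM.
by rewrite Posz_oppS expgz_pred; apply: subgroupM => //; exact: subgroupV.
Qed.

Lemma is_word_cat (A : set G) (v w : seq G) : is_word A v -> is_word A w -> is_word A (v ++ w).
Proof. by move=> hv hw a; rewrite mem_cat => /orP[/hv|/hw]. Qed.

Lemma is_word_letters (A : set G) (w : seq G) : is_word A w -> forall a, a \in w ->
  is_word A [:: a] /\ is_word A [:: a^-1].
Proof.
move=> hw a /hw aA; split=> b; rewrite inE => /eqP-> //.
by rewrite invgK; case: aA; [right | left].
Qed.

(** Here and below, [is_word A [:: a]] expresses that [a] is a letter, that is, [a] or [a^-1] lies
    in [A]. *)
Lemma generated_ind (A P : set G) : is_subgroup P ->
  (forall a, is_word A [:: a] -> P a) -> generated A `<=` P.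
Proof.
move=> hP hA x [w hw ->]; elim: w hw => [|a w IH] hw; first by rewrite big_nil; exact: hP.1.
rewrite big_cons; apply: subgroupM => //.
  by apply: hA; have [] := is_word_letters hw (mem_head a w).
by apply: IH => b bw; apply: hw; rewrite inE bw orbT.
Qed.

End Words.

Lemma gmulf_expgz (G H : groupType) (f : {multiplicative G -> H}) (x : G) (n : int) :
  f (expgz x n) = expgz (f x) n.
Proof.
have f1 : f 1 = 1 by apply: (mulgI (f 1)); rewrite -gmulfM !mulg1.
have fV y : f y^-1 = (f y)^-1 by apply: (mulgI (f y)); rewrite -gmulfM !mulgV.
have fX k : f (x ^+ k) = f x ^+ k.
  by elim: k => [|k IH]; rewrite ?expg0 // !expgS gmulfM IH.
case: (intP n) => [|k|k]; first exact: f1.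
  by rewrite !expgz_nat fX.
by rewrite !expgz_natN fV fX.
Qed.

Definition mult_of (G H : groupType) (f : G -> H) (fM : {morph f : x y / x * y}) :
    {multiplicative G -> H} :=
  HB.pack_for {multiplicative G -> H} f (isMultiplicative.Build G H f fM).

Lemma isom_toI (G H : groupType) (S : set G) (f : H -> G) :
  {morph f : x y / x * y} -> injective f -> range f = S -> isom_to H S.
Proof. by move=> fM fI fS; exists (mult_of fM). Qed.

(** * Subgroups of the semidirect product with small or large kernel *)

Section SubgroupsOfHnn.
Variables (K : groupType) (alpha : group_aut K).
Hypothesis tf : torsion_free K.
Local Notation inK := (hnn_in alpha).

Lemma hnn_in_inj : injective inK. Proof. by move=> x y []. Qed.

Lemma hnn_expM (x y : hnn alpha) : hnn_exp (x * y) = (hnn_exp x + hnn_exp y)%R.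
Proof. by []. Qed.

Lemma hnn_expV (x : hnn alpha) : hnn_exp x^-1 = (- hnn_exp x)%R.
Proof. by []. Qed.

Lemma hnn_exp_expgz (x : hnn alpha) (n : int) : hnn_exp (expgz x n) = (n * hnn_exp x)%R.
Proof.
elim/int_ind: n => [|n IH|n IH]; first by rewrite mul0r.
  by rewrite Posz_succ expgzD expgz1 hnn_expM IH mulrDl mul1r.
by rewrite Posz_oppS expgz_pred hnn_expM hnn_expV IH mulrBl mul1r addrC.
Qed.

Lemma hnn_in_base (x : hnn alpha) : hnn_exp x = 0%R -> x = inK (hnn_base x).
Proof. by case: x => k n /= ->. Qed.

Lemma hnn_in_expgz (k : K) (n : int) : inK (expgz k n) = expgz (inK k) n.
Proof. exact: gmulf_expgz. Qed.

(** The image of [S] under [hnn_exp] is cyclic too, generated by the exponent of some [s], so every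
    element is [expgz D m * expgz s k]. Whether [d] and [hnn_exp s] are trivial and, if neither is,
    whether [s] conjugates [D] to [D] or to its inverse decides among the four groups. *)
Lemma cyclic_kernel_small (S : set (hnn alpha)) (d : K) : is_subgroup S -> S (inK d) ->
    (forall k, S (inK k) -> exists n : int, k = expgz d n) ->
  [\/ isom_to trivial_group S, isom_to Zgroup S, isom_to (Zgroup * Zgroup)%type S |
      isom_to Klein_bottle_group S].
Proof.
move=> hS Sd dgen.
have [||_ [s Ss <-] sgen] := @int_subgroup_cyclic ((@hnn_exp K alpha) @` S).
- by exists 1 => //; exact: hS.1.
- by move=> _ _ [x Sx <-] [y Sy <-]; exists (x / y); first exact: hS.2.
set D := inK d.
have decomp g : S g -> exists m k : int, g = expgz D m * expgz s k.
  move=> Sg; have [|k ek] := sgen (hnn_exp g); first by exists g.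
  have Sgk : S (g * expgz s (- k)%R) by apply: subgroupM => //; exact: subgroup_expgz.
  have e0 : hnn_exp (g * expgz s (- k)%R) = 0%R.
    by rewrite hnn_expM hnn_exp_expgz ek mulNr subrr.
  move: (Sgk); rewrite (hnn_in_base e0) => /dgen[m em]; exists m, k.
  by rewrite -hnn_in_expgz -em -hnn_in_base // expgzN mulgVK.
have SD m : S (expgz D m) by exact: subgroup_expgz.
have Ssk k : S (expgz s k) by exact: subgroup_expgz.
have expD m : hnn_exp (expgz D m) = 0%R by rewrite hnn_exp_expgz mulr0.
have DI : d != 1 -> injective (expgz D).
  move=> d1 m n; rewrite -!hnn_in_expgz => /hnn_in_inj.
  exact: expgz_inj.
have powM (x : hnn alpha) : {morph (expgz x : Zgroup -> hnn alpha) : m n / m * n}.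
  by move=> m n; exact: (@expgzD (hnn alpha) x m n).
have [d1|d1] := eqVneq d 1.
  have D1 m : expgz D m = 1 by rewrite /D d1 -hnn_in_expgz expgz1n.
  have [s0|s0] := eqVneq (hnn_exp s) 0%R.
    constructor 1.
    have oneM : {morph (fun _ : trivial_group => 1 : hnn alpha) : m n / m * n}.
      by move=> m n; rewrite mulg1.
    apply: (isom_toI oneM).
      by move=> x y _; apply: val_inj; case: x y => [[|?] ?] [[|?] ?].
    apply/seteqP; split=> [_ [x _ <-]|g Sg]; first exact: hS.1.
    exists 1 => //=; have [m [k ->]] := decomp g Sg.
    rewrite D1 mul1g; move: (Ss); rewrite (hnn_in_base s0) => /dgen[n ->].
    by rewrite d1 expgz1n -hnn_in_expgz expgz1n.
  constructor 2; apply: (isom_toI (powM s)).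
    move=> m n /= e; have := congr1 (@hnn_exp K alpha) e; rewrite !hnn_exp_expgz.
    exact: mulIf.
  apply/seteqP; split=> [_ [n _ <-]|g Sg]; first exact: Ssk.
  by have [m [k ->]] := decomp g Sg; exists k => //; rewrite D1 mul1g.
have [s0|s0] := eqVneq (hnn_exp s) 0%R.
  constructor 2; apply: (isom_toI (powM D)); first exact: DI.
  apply/seteqP; split=> [_ [n _ <-]|g Sg]; first exact: SD.
  have [m [k ->]] := decomp g Sg.
  move: (Ss); rewrite (hnn_in_base s0) => /dgen[n ->].
  by exists (m + n * k)%R => //=; rewrite expgzD hnn_in_expgz expgzM.
have inj2 (m k m' k' : int) :
    expgz D m * expgz s k = expgz D m' * expgz s k' -> m = m' /\ k = k'.
  move=> e; have kk : k = k'.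
    have := congr1 (@hnn_exp K alpha) e.
    by rewrite !hnn_expM !expD !add0r !hnn_exp_expgz; exact: mulIf.
  by split=> //; move: e; rewrite kk => /mulIg/DI; exact.
have conjD g : S g -> exists m, g * D * g^-1 = expgz D m.
  move=> Sg; have SgD : S (g * D * g^-1) by apply: hS.2 => //; exact: subgroupM.
  have e0 : hnn_exp (g * D * g^-1) = 0%R by rewrite !hnn_expM hnn_expV addr0 subrr.
  move: (SgD); rewrite {1}(hnn_in_base e0) => /dgen[m em]; exists m.
  by rewrite (hnn_in_base e0) em hnn_in_expgz.
have [e es] := conjD s Ss.
have [e' es'] := conjD s^-1 (subgroupV hS Ss).
have ee : (e * e' = 1)%R.
  apply: (DI d1); rewrite expgzM -es expgz_conj -es' expgz1.
  by rewrite invgK !mulgA mulgV mul1g mulgK.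
case/int_mul_eq1: ee => e1; rewrite e1 ?expgzN expgz1 in es.
- constructor 3.
  have sD : commute s D by rewrite /commute -{2}es mulgVK.
  have fM : {morph (fun p : Zgroup * Zgroup => expgz D p.1 * expgz s p.2) : p q / p * q}.
    move=> [m k] [m' k'] /=.
    rewrite [LHS](_ : _ = expgz D (m + m')%R * expgz s (k + k')%R) // !expgzD.
    rewrite -!mulgA; congr (_ * _); rewrite !mulgA; congr (_ * _).
    by apply: commute_expgz; apply/commute_sym/commute_expgz.
  apply: (isom_toI fM); first by move=> [m k] [m' k'] /= /inj2[-> ->].
  apply/seteqP; split=> [_ [[m k] _ <-]|g Sg]; first exact: subgroupM.
  by have [m [k ->]] := decomp g Sg; exists (m, k).
- constructor 4.
  have [|g [gt gD _]] := @hnn_presentation _ Zinv_aut (hnn alpha) (mult_of (powM D)) s.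
    move=> k /=; rewrite -expgz_conj es [RHS](_ : _ = expgz D (- (k : int))%R) //.
    by rewrite -{1}(expgz1 D) -expgzN -expgzM mulN1r.
  have gE (x : Klein_bottle_group) : g x = expgz D (hnn_base x) * expgz s (hnn_exp x).
    by rewrite {1}[x]hnn_decomp gmulfM gD gmulf_expgz gt.
  exists g; split.
    by move=> [m k] [m' k']; rewrite !gE /= => /inj2[-> ->].
  apply/seteqP; split=> [_ [x _ <-]|x Sx]; first by rewrite gE; exact: subgroupM.
  by have [m [k ->]] := decomp x Sx; exists (HNN Zinv_aut m k) => //; rewrite gE.
Qed.

(** The bound 6 arises because a commutator [c] of two letters has 4 letters and its conjugate
    [s * c * s^-1] by a letter has 6. Without such a pair the kernel [L] of [hnn_exp] on [S] would
    be cyclic, which [cyclic_kernel_small] excludes. *)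
Lemma noncommuting_pair (A S : set (hnn alpha)) :
    cocyclic_centralizers K -> is_subgroup S -> fin_gen A S ->
    ~ isom_to trivial_group S -> ~ isom_to Zgroup S ->
    ~ isom_to (Zgroup * Zgroup)%type S -> ~ isom_to Klein_bottle_group S ->
  exists x y : K, [/\ ~ commute x y,
    exists w, [/\ is_word A w, (size w <= 6)%N & inK x = \prod_(a <- w) a] &
    exists w, [/\ is_word A w, (size w <= 6)%N & inK y = \prod_(a <- w) a]].
Proof.
move=> cc hS [_ gA] n1 n2 n3 n4; apply: contrapT => H.
have letterS a : is_word A [:: a] -> S a.
  by rewrite -gA => ha; exists [:: a] => //; rewrite big_seq1.
pose L := [set k | S (inK k)].
have hL : is_subgroup L.
  split; first exact: hS.1.
  move=> x y Lx Ly; rewrite /L /=.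
  suff -> : inK (x / y) = inK x / inK y by apply: hS.2.
  by apply: (mulIg (inK y)); rewrite -gmulfM !mulgVK.
have notcyc (d : K) : L d -> ~ forall k, L k -> exists n : int, k = expgz d n.
  by move=> Ld dgen; have [] := cyclic_kernel_small hS Ld dgen.
have notcent (x : K) : x != 1 -> ~ forall k, L k -> commute k x.
  by move=> x1 Lx; have [d Ld] := abelian_subgroup_cyclic tf cc hL x1 Lx; exact: notcyc.
(* If all letters commute, then [S] is abelian, and its kernel [L] is trivial or centralizes a
   nontrivial element. *)
have [ab|nab] := pselect (forall a b, is_word A [:: a] -> is_word A [:: b] -> commute a b).
  have Sab x y : S x -> S y -> commute x y.
    pose T := [set z : hnn alpha | forall a, is_word A [:: a] -> commute z a].
    rewrite -gA => /(@generated_ind _ A [set z | commute z y]) Hx.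
    move=> /(@generated_ind _ A T) Hy.
    have csub (z : hnn alpha) : is_subgroup [set u | commute u z].
      split; first exact/commute_sym/commute1.
      by move=> u v /= /commute_sym uz /commute_sym vz; exact/commute_sym/commuteM/commuteV.
    apply: Hx => // a ha /=; apply/commute_sym; apply: Hy => // [|b hb c hc]; last exact: ab.
    split=> [c hc|u v hu hv c hc]; first exact: (csub c).1.
    by apply: (csub c).2; [exact: hu | exact: hv].
  have [[x Lx x1]|triv] := pselect (exists2 x, L x & x != 1).
    by apply: (notcent x x1) => k Lk; apply: hnn_in_inj; rewrite !gmulfM; exact: Sab.
  apply: (notcyc 1 hL.1) => k Lk; exists 0%R; apply: contrapT => /eqP k1.
  by apply: triv; exists k.
apply: nab => a b ha hb; apply: contrapT => nab.
pose c := a * b * a^-1 * b^-1.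
have c0 : hnn_exp c = 0%R by rewrite !hnn_expM !hnn_expV; lia.
pose x := hnn_base c; have ec : inK x = c by rewrite -hnn_in_base.
have x1 : x != 1.
  apply/eqP => e; apply: nab; move: ec; rewrite e /c => /esym/divg1_eq ec.
  by rewrite /commute -{2}ec mulgVK.
have hc : is_word A [:: a; b; a^-1; b^-1].
  have [] := is_word_letters ha (mem_head _ _); have [] := is_word_letters hb (mem_head _ _).
  move=> _ hbV _ haV z; rewrite !inE => /or4P[] /eqP ->.
  - exact/ha/mem_head. - exact/hb/mem_head. - exact/haV/mem_head. - exact/hbV/mem_head.
have pc : c = \prod_(a <- [:: a; b; a^-1; b^-1]) a.
  by rewrite !big_cons big_nil mulg1 /c !mulgA.
pose T := [set g : hnn alpha | commute (g * c * g^-1) c].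
have conj0 (g : hnn alpha) (k : K) : exists k', g * inK k * g^-1 = inK k'.
  by eexists; apply: hnn_in_base; rewrite !hnn_expM hnn_expV addr0 subrr.
have trans (u v w : hnn alpha) : (exists k, u = inK k) -> (exists k, v = inK k) ->
    (exists k, w = inK k) -> v <> 1 -> commute u v -> commute v w -> commute u w.
  move=> [u' ->] [v' ->] [w' ->] v1.
  rewrite /commute -!gmulfM => /hnn_in_inj uv /hnn_in_inj vw; congr (inK _).
  apply: (commute_trans tf cc (x := v')) => //; first by apply/eqP => e; apply: v1; rewrite e.
have cne : c <> 1 by rewrite -ec => e; case/eqP: x1; exact: hnn_in_inj.
have conjne (g : hnn alpha) : g * c * g^-1 <> 1.
  by move/(congr1 (fun z => g^-1 * z * g)); rewrite !mulgA mulVg mul1g mulgVK mulg1 mulVg.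
have conjc (g u v : hnn alpha) : commute u v -> commute (g * u * g^-1) (g * v * g^-1).
  by rewrite /commute => e; rewrite !mulgA !mulgVK -!(mulgA g) -!mulgA !(mulgA _ _ g^-1) e.
have cK : exists k, c = inK k by exists x.
have cgK g : exists k, g * c * g^-1 = inK k by rewrite -ec; exact: conj0.
(* For [g] and [h] in [T], the conjugate of [c] by [g / h] commutes with [g * c * g^-1], which
   commutes with [c]; commuting is transitive through nontrivial elements of [K]. *)
have TM : is_subgroup T.
  split; first by rewrite /T /= mul1g invg1 mulg1.
  move=> g h Tg Th; rewrite /T /=.
  have Th' : commute (h^-1 * c * h) c.
    by have := conjc h^-1 _ _ Th; rewrite invgK !mulgA mulVg mul1g mulgVK => /commute_sym.
  apply: (trans _ (g * c * g^-1)) => //.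
  have := conjc g _ _ Th'; rewrite !invgM invgK !mulgA //.
have ST : S `<=` T.
  rewrite -gA; apply: generated_ind => // s hs; apply: contrapT => ns; apply: H.
  have [y ey] := cgK s.
  have [_ hsV] := is_word_letters hs (mem_head _ _).
  exists x, y; split.
  - by move=> xy; apply: ns; rewrite /T /= ey -ec /commute -!gmulfM xy.
  - by exists [:: a; b; a^-1; b^-1]; rewrite ec pc.
  - exists ([:: s] ++ [:: a; b; a^-1; b^-1] ++ [:: s^-1]); split => //.
      exact/is_word_cat/is_word_cat.
    by rewrite !big_cat /= !big_seq1 -pc -ey; exact: esym (mulgA s c s^-1).
apply: (notcent x x1) => k Lk; apply: (commute_of_conj tf cc x1).
have ek : inK (k * x * k^-1) = inK k * c * (inK k)^-1.
  by apply: (mulIg (inK k)); rewrite -hnn_inM !mulgVK hnn_inM ec.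
by apply: hnn_in_inj; rewrite hnn_inM [RHS]hnn_inM ek ec; exact: (ST _ Lk).
Qed.

End SubgroupsOfHnn.

(** * Growth *)

Section Fekete.
Variables (R : realType) (u : nat -> R).
Hypothesis u_ge0 : forall n, (0 <= u n)%R.
Hypothesis u_subadd : forall m n, (u (m + n)%N <= u m + u n)%R.
Local Open Scope ring_scope.

Let subadd_mul m q r : u (q * m + r)%N <= q%:R * u m + u r.
Proof.
elim: q => [|q IH]; first by rewrite mul0n add0n mul0r add0r.
rewrite mulSn -addnA (le_trans (u_subadd _ _)) //.
by rewrite mulrSr mulrDl mul1r; lra.
Qed.

Let ratios : set R := [set u n / n%:R | n in [set n | (0 < n)%N]].

(** Fekete's subadditive lemma: divide [n] by an [m] whose ratio nearly attains the infimum; the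
    remainder contributes at most the constant [B], negligible against [n]. *)
Lemma fekete : (fun n => u n / n%:R) @ \oo --> inf ratios.
Proof.
have lb0 : lbound ratios 0 by move=> _ [n _ <-]; rewrite divr_ge0.
have hinf : has_inf ratios by split; [exists (u 1%N / 1%:R), 1%N | exists 0].
apply/cvgrPdist_le => e e0.
have [_ [m /= m0 <-] hm] := inf_adherent (divr_gt0 e0 (ltr0n R 2)) hinf.
pose B := \sum_(i < m) u i.
have uB r : (r < m)%N -> u r <= B.
  by move=> rm; rewrite /B (bigD1 (Ordinal rm)) //= lerDl sumr_ge0.
have B0 : 0 <= B by rewrite sumr_ge0.
near=> n.
have n0 : (0 < n)%N by near: n; exact: nbhs_infty_gt.
have nR : 0 < n%:R :> R by rewrite ltr0n.
have hB : B / (e / 2) <= n%:R by near: n; exact: nbhs_infty_ger.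
have lo : inf ratios <= u n / n%:R by apply: ge_inf; [exists 0 | exists n].
have mR : 0 < m%:R :> R by rewrite ltr0n.
have up : u n / n%:R <= u m / m%:R + e / 2.
  rewrite ler_pdivrMr //.
  have -> : u n = u (n %/ m * m + n %% m)%N by rewrite -divn_eq.
  apply: le_trans (subadd_mul _ _ _) _.
  have h1 : (n %/ m)%:R * u m <= u m / m%:R * n%:R.
    rewrite mulrC -mulrA ler_wpM2l // mulrC ler_pdivlMr // -natrM ler_nat.
    exact: leq_divM.
  have h2 : u (n %% m)%N <= e / 2 * n%:R.
    apply: le_trans (uB _ (ltn_pmod n m0)) _.
    by move: hB; rewrite ler_pdivrMr ?divr_gt0 // mulrC.
  by rewrite mulrDl; lra.
rewrite ler_norml; lra.
Unshelve. all: by end_near. Qed.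

Lemma fekete_ge (c : R) : (forall n, (0 < n)%N -> c * n%:R <= u n) -> c <= inf ratios.
Proof.
move=> hc; apply: lb_le_inf; first by exists (u 1%N / 1%:R), 1%N.
by move=> _ [n /= n0 <-]; rewrite ler_pdivlMr ?ltr0n // hc.
Qed.

End Fekete.

(** * Balls, growth functions and free semigroups *)

Section Balls.
Variable G : groupType.
Implicit Types (A : set G) (x y : G).

(** The ball of the word metric, stated without the default value that [word_length] takes outside
    [generated A]; [ballE] shows that it is the set counted by [growth_function]. *)
Definition short (A : set G) (n : nat) (x : G) : Prop :=
  exists w, [/\ is_word A w, (size w <= n)%N & x = \prod_(a <- w) a].

Lemma short1 A n : short A n 1.
Proof. by exists [::]; rewrite big_nil. Qed.

Lemma shortM A m n x y : short A m x -> short A n y -> short A (m + n) (x * y).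
Proof.
move=> [v [vA vm ->]] [w [wA wn ->]]; exists (v ++ w).
by split; [exact: is_word_cat | rewrite size_cat leq_add | rewrite big_cat].
Qed.

Lemma shortX A m x k : short A m x -> short A (k * m) (x ^+ k).
Proof.
move=> h; elim: k => [|k IH]; first by rewrite expg0; exact: short1.
by rewrite expgS mulSn; exact: shortM.
Qed.

Lemma shortV A m x : short A m x -> short A m x^-1.
Proof.
move=> [w [wA wm ->]]; exists (rev (map (fun a => a^-1) w)); split.
- by move=> a; rewrite mem_rev => /mapP[b /wA hb ->]; rewrite invgK; case: hb; [right|left].
- by rewrite size_rev size_map.
- elim: w {wA wm} => [|a w IH]; first by rewrite !big_nil invg1.
  by rewrite big_cons invgM /= rev_cons -cats1 big_cat big_seq1 IH.
Qed.

Lemma short_split A m n x : short A (m + n) x ->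
  exists y z, [/\ short A m y, short A n z & x = y * z].
Proof.
move=> [w [wA wmn ->]].
exists (\prod_(a <- take m w) a), (\prod_(a <- drop m w) a); split.
- exists (take m w); split=> //; last by rewrite size_take; case: ltnP.
  by move=> a /mem_take/wA.
- exists (drop m w); split=> //; last by rewrite size_drop leq_subLR.
  by move=> a /mem_drop/wA.
- by rewrite -big_cat cat_take_drop.
Qed.

Lemma ballE A n : [set x | generated A x /\ (word_length A x <= n)%N] = [set x | short A n x].
Proof.
apply/seteqP; split=> x /=; rewrite /word_length.
  move=> [[w wA ->]]; case: pselect => [ex|nex] /=.
    case: ex_minnP => m /asboolP[v [vA <- ev]] _ vn.
    by exists v.
  by case: nex; exists (size w); apply/asboolP; exists w.
move=> [w [wA wn ex]]; split; first by exists w.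
case: pselect => [ex'|//] /=; case: ex_minnP => m _ hm.
by apply: leq_trans (hm (size w) _) wn; apply/asboolP; exists w.
Qed.

Lemma finite_short A n : finite_set A -> finite_set [set x | short A n x].
Proof.
move=> fA; elim: n => [|n IH].
  apply: (sub_finite_set _ (finite_set1 (1 : G))) => x [w [_ w0 ->]].
  by move: w0; rewrite leqn0 size_eq0 => /eqP->; rewrite big_nil.
pose AV := A `|` (fun a => a^-1) @` A.
have fAV : finite_set AV by rewrite finite_setU; split=> //; exact: finite_image.
have f2 := finite_image2 (fun a x : G => a * x) fAV IH.
have : finite_set ([set 1 : G] `|` [set a * x | a in AV & x in [set x | short A n x]]).
  by rewrite finite_setU; split=> //; exact: finite_set1.
apply: sub_finite_set => x [[|a w] [wA wn ->]]; first by left; rewrite big_nil.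
right; rewrite big_cons; exists a.
  by case: (wA a (mem_head _ _)) => h; [left | right; exists a^-1; rewrite ?invgK].
exists (\prod_(a <- w) a) => //; exists w; split=> // b bw.
by apply: wA; rewrite inE bw orbT.
Qed.

Lemma growth_functionE A n : growth_function A n = size (fset_set [set x | short A n x]).
Proof. by rewrite /growth_function ballE. Qed.

Lemma growth_function_gt0 A n : finite_set A -> (0 < growth_function A n)%N.
Proof.
move=> fA; rewrite growth_functionE.
have : 1 \in fset_set [set x | short A n x].
  by rewrite in_fset_set ?inE; [exact: short1 | exact: finite_short].
by move=> h; rewrite cardfs_gt0; apply/fset0Pn; exists 1.
Qed.

Lemma growth_functionM A m n : finite_set A ->
  (growth_function A (m + n) <= growth_function A m * growth_function A n)%N.
Proof.
move=> fA; rewrite !growth_functionE.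
set Bm := fset_set [set x | short A m x]; set Bn := fset_set [set x | short A n x].
have mem k x : x \in fset_set [set x | short A k x] <-> short A k x.
  by rewrite in_fset_set ?inE //; exact: finite_short.
rewrite -(size_allpairs (fun x y => x * y)).
apply: uniq_leq_size; first exact: fset_uniq.
move=> x /mem/short_split[y [z [/mem yB /mem zB ->]]].
by apply/allpairsP; exists (y, z).
Qed.

(** The positive words of length [n] in [u] and [v] give distinct elements, each spelled with at
    most [n * N] letters. *)
Lemma growth_function_free A N (u v : G) n : finite_set A ->
    short A N u -> short A N v -> free_pair u v ->
  (2 ^ n <= growth_function A (n * N))%N.
Proof.
move=> fA uN vN fr; rewrite growth_functionE.
pose f (t : n.-tuple bool) := letter_word (fun b => if b then u else v) t.
have fI : injective f.
  by move=> s t e; apply: val_inj; apply: fr => //=; rewrite !size_tuple.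
have <- : size (map f (enum {: n.-tuple bool})) = (2 ^ n)%N.
  by rewrite size_map -cardE card_tuple card_bool.
apply: uniq_leq_size; first by rewrite map_inj_uniq // enum_uniq.
move=> _ /mapP[t _ ->]; rewrite in_fset_set ?inE; last exact: finite_short.
rewrite /f /=; have := size_tuple t; move: (val t) => s <- {t f fI}.
elim: s => [|b s IH]; first by rewrite /letter_word big_nil; exact: short1.
by rewrite /letter_word big_cons mulSn; apply: shortM => //; case: b.
Qed.

(** The logarithm of the growth function is subadditive, so by [fekete] the growth rate is the
    exponential of an infimum, and a lower bound is required at every positive [n]. *)
Lemma growth_rate_free (R : realType) A N (u v : G) : finite_set A -> (0 < N)%N ->
    short A N u -> short A N v -> free_pair u v ->
  (expR (ln 2 / N%:R) <= growth_rate R A)%R.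
Proof.
move=> fA N0 uN vN fr.
pose l n : R := ln (growth_function A n)%:R.
have g1 n : (1 <= (growth_function A n)%:R :> R)%R by rewrite ler1n growth_function_gt0.
have g0 n : (0 < (growth_function A n)%:R :> R)%R by rewrite ltr0n growth_function_gt0.
have l0 n : (0 <= l n)%R by rewrite ln_ge0.
have lD m n : (l (m + n)%N <= l m + l n)%R.
  rewrite -lnM ?posrE // ler_ln ?posrE ?mulr_gt0 //.
  by rewrite -natrM ler_nat growth_functionM.
have lim := fekete l0 lD.
have -> : growth_rate R A = expR (inf [set l n / n%:R | n in [set n | (0 < n)%N]])%R.
  apply/cvg_lim => //.
  have -> : (fun n => (growth_function A n)%:R `^ (n%:R^-1) : R)%R
      = expR \o (fun n => l n / n%:R)%R.
    by apply/funext => n /=; rewrite /powR gt_eqF // mulrC.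
  by apply: continuous_cvg => //; exact: continuous_expR.
rewrite ler_expR; apply: fekete_ge => n n0.
(* The free pair bounds [l] from below only at multiples of [N]; subadditivity carries the bound
   from [N * n] back to [n]. *)
have lM k : (l (k.+1 * n)%N <= k.+1%:R * l n)%R.
  elim: k => [|k IH]; first by rewrite mul1n mul1r.
  by rewrite mulSn (le_trans (lD _ _)) // [(k.+2%:R)%R]mulrS mulrDl mul1r lerD2l.
have h : (n%:R * ln 2 <= l (N * n)%N)%R.
  rewrite mulr_natl -lnXn // -natrX /l ler_ln ?posrE ?g0 ?ltr0n ?expn_gt0 // ler_nat mulnC.
  exact: growth_function_free fA uN vN fr.
move: (lM N.-1); rewrite prednK // => /(le_trans h) {}h.
by rewrite mulrAC ler_pdivrMr ?ltr0n // mulrC (mulrC (l n)).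
Qed.

End Balls.

(** * Word lengths as hyperbolic length functions *)

Section WordLength.
Variables (K : groupType) (A : set K).
Hypothesis gen : generated A = [set: K].
Local Notation len := (word_length A).

Lemma short_lenE n (x : K) : short A n x <-> (len x <= n)%N.
Proof.
have gx : generated A x by rewrite gen.
by have /seteqP[/(_ x) /= h1 /(_ x) /= h2] := ballE A n; split=> [/h2[]//|h]; apply: h1.
Qed.

Lemma word_lenM (x y : K) : (len (x * y) <= len x + len y)%N.
Proof. by apply/short_lenE/shortM; apply/short_lenE. Qed.

Lemma word_lenV (x : K) : len x^-1 = len x.
Proof.
have H y : (len y^-1 <= len y)%N by apply/short_lenE/shortV/short_lenE.
by apply/eqP; rewrite eqn_leq H -{1}(invgK x) H.
Qed.

Lemma word_length_geodesic : geodesic_length len.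
Proof.
move=> x k kx; have : short A (k + (len x - k)) x by rewrite subnKC //; exact/short_lenE.
move=> /short_split[y [z [/short_lenE ly /short_lenE lz ex]]].
have := word_lenM y z; rewrite -ex => lyz; exists y; rewrite ex mulKg -ex.
by split; lia.
Qed.

Lemma word_length_finite_balls : finite_set A -> finite_balls len.
Proof.
move=> fA n; exists (fset_set [set x | short A n x]) => x xn.
by rewrite in_fset_set ?inE; [exact/short_lenE | exact: finite_short].
Qed.

Lemma word_length_hyperbolic (R : realType) (delta : R) :
    (forall w x y z, Num.min (gromov_product R A w x y) (gromov_product R A w y z) - delta
         <= gromov_product R A w x z)%R ->
  exists D, hyperbolic_length len D.
Proof.
(* The factor 2 is there because [gp] is twice the Gromov product; the absolute value allows a
   negative [delta]. *)
move=> hyp; exists (Num.bound `|2 * delta|%R); split.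
- by apply/eqP; rewrite -leqn0; apply/short_lenE/short1.
- exact: word_lenV.
- exact: word_lenM.
move=> o x y z.
have gpE u v : gromov_product R A o u v = ((gp len o u v)%:R / 2)%R.
  rewrite /gromov_product /gp natrB ?natrD //.
  have := word_lenM (o^-1 * u)^-1 (o^-1 * v).
  by rewrite word_lenV invgM invgK mulgA mulgK.
have := hyp o x y z; rewrite !gpE.
have := archi_boundP (normr_ge0 (2 * delta)%R) => hD.
have hd := ler_norm (2 * delta)%R.
rewrite -(ler_nat R) natrD.
have [h|h] := leqP (gp len o x y) (gp len o y z).
  have h' : ((gp len o x y)%:R / 2 <= (gp len o y z)%:R / 2 :> R)%R.
    by rewrite ler_pM2r ?invr_gt0 ?ltr0n // ler_nat.
  by rewrite min_l //; lra.
have h' : ((gp len o y z)%:R / 2 <= (gp len o x y)%:R / 2 :> R)%R.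
  by rewrite ler_pM2r ?invr_gt0 ?ltr0n // ler_nat ltnW.
by rewrite min_r //; lra.
Qed.

End WordLength.

(** * Centralizers and free pairs in torsion free hyperbolic groups *)

Section HyperbolicGroup.
Variables (K : groupType) (len : K -> nat) (D : nat).
Hypotheses (hL : hyperbolic_length len D) (fin : finite_balls len).
Hypotheses (geo : geodesic_length len) (tf : torsion_free K).

Lemma conjg_expz (p x : K) (n : int) : expgz (p^-1 * x * p) n = p^-1 * expgz x n * p.
Proof. by have := expgz_conj p^-1 x n; rewrite invgK. Qed.

(** Conjugation turns a power of [x] into an axial [h]. Powers of [h] move each element commuting
    with [h] into a fixed finite ball, and conjugating this ball back gives the list. *)
Lemma hyperbolic_cocyclic_centralizers : cocyclic_centralizers K.
Proof.
move=> x x1; have [M hM] := exists_axial_power hL fin geo tf.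
have [j [p [_ _ ah]]] := hM x x1; set h := p^-1 * x ^+ j * p in ah.
have [C hC] := centralizer_axial_cobounded hL ah.
have [s hs] := fin C.
exists [seq p * q * p^-1 | q <- s] => g gx.
have gh : commute (p^-1 * g * p) h.
  have gxj := commuteX j gx.
  by rewrite /commute /h !mulgA !mulgK -!(mulgA p^-1) -!mulgA (mulgA g) gxj !mulgA.
have [a [b /hs hab]] := hC _ gh.
exists (j%:Z * (a%:Z - b%:Z))%R; apply/mapP; exists (h ^+ a * h ^- b * (p^-1 * g * p)) => //.
rewrite -(expgz_nat h a) -(expgz_natN h b) -expgzD conjg_expz -expgz_nat -expgzM.
by rewrite !mulgA mulgV mul1g mulgK mulgK.
Qed.

(** The exponent is [j * n], with [j <= M] and [n] independent of the pair. If [y] conjugated a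
    nontrivial power of [x] to itself or to its inverse, then [commute_of_conj] and [commute_trans]
    would make [y] commute with [x]. *)
Lemma uniform_free_pair : exists2 N, (0 < N)%N & forall x y : K, ~ commute x y ->
  exists2 k, (k <= N)%N & free_pair (x ^+ k) (y * x ^+ k * y^-1).
Proof.
have cc := hyperbolic_cocyclic_centralizers.
have [M hM] := exists_axial_power hL fin geo tf.
have [n n0 hn] := uniform_ping_pong hL fin.
exists (M * n).+1 => // x y xy.
have x1 : x != 1 by apply/eqP => e; apply: xy; rewrite e; exact/commute_sym/commute1.
have [j [p [j0 jM ag]]] := hM x x1; exists (j * n)%N.
  by rewrite leqW // leq_mul2r jM orbT.
have conjX m : (p^-1 * x ^+ j * p) ^+ m = p^-1 * x ^+ (j * m) * p.
  by rewrite -(expgz_nat (p^-1 * x ^+ j * p)) conjg_expz expgz_nat expgnA.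
have conjy (z : K) : (p^-1 * y * p) * (p^-1 * z * p) * (p^-1 * y * p)^-1
    = p^-1 * (y * z * y^-1) * p.
  by rewrite !invgM invgK !mulgA !mulgK.
have nc m : (0 < m)%N -> ~ commute (y * x ^+ (j * m) * y^-1) (x ^+ (j * m)).
  move=> m0; set c := x ^+ (j * m) => yc.
  have c1 : c != 1.
    by apply: contra x1 => /eqP e; apply/eqP; apply: (tf _ e); rewrite muln_gt0 j0.
  apply: xy; apply: (commute_trans tf cc c1); first exact: commuteX.
  exact: (commute_of_conj tf cc c1).
have := hn (p^-1 * x ^+ j * p) (p^-1 * y * p) ag; rewrite conjX conjy => H.
apply: (@free_pair_conj _ p^-1); rewrite invgK; apply: H => m m0.
- rewrite conjX conjy => /mulIg/mulgI e; apply: (nc m m0); rewrite e; exact: commute_refl.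
- have cV : (p^-1 * x ^+ (j * m) * p)^-1 = p^-1 * x ^- (j * m) * p.
    by rewrite !invgM invgK mulgA.
  rewrite conjX conjy cV => /mulIg/mulgI e; apply: (nc m m0); rewrite e.
  exact/commute_sym/commuteV.
Qed.

End HyperbolicGroup.

(** * The uniform growth bound *)

Lemma free_pair_morph (G H : groupType) (f : {multiplicative G -> H}) (u v : G) :
  injective f -> free_pair u v -> free_pair (f u) (f v).
Proof.
move=> fI fr s t st.
have f1 : f 1 = 1 by apply: (mulgI (f 1)); rewrite -gmulfM !mulg1.
have fw (w : seq bool) : letter_word (fun b => if b then f u else f v) w
    = f (letter_word (fun b => if b then u else v) w).
  elim: w => [|b w IH]; first by rewrite /letter_word !big_nil f1.
  by move: IH; rewrite /letter_word !big_cons gmulfM => ->; case: b.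
by rewrite !fw => /fI; exact: fr.
Qed.

Theorem corollary4p3 (R : realType) (K : groupType)
    (K_torsion_free : torsion_free K)
    (K_hyperbolic : word_hyperbolic R K)
    (K_linear : linear_group K) :
  exists k : R, (1 < k)%R /\
    forall (alpha : group_aut K) (S : set (hnn alpha)),
      is_subgroup S -> finitely_generated S ->
      ~ isom_to trivial_group S ->
      ~ isom_to Zgroup S ->
      ~ isom_to (Zgroup * Zgroup)%type S ->
      ~ isom_to Klein_bottle_group S ->
      (k <= growth_constant R S)%R.
Proof.
have [A [[fA gA] [delta hyp]]] := K_hyperbolic.
have [D hL] := word_length_hyperbolic gA hyp.
have fin := word_length_finite_balls gA fA.
have geo := word_length_geodesic gA.
have cc := hyperbolic_cocyclic_centralizers hL fin geo K_torsion_free.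
have [N N0 hN] := uniform_free_pair hL fin geo K_torsion_free.
(* As [x] and [y] have length at most 6, the second free generator [y * x ^+ k * y^-1] has length at
   most [6 + 6 * k + 6]. The constant is fixed before [alpha] and [S] are introduced. *)
exists (expR (ln 2 / (12 + 6 * N)%:R)%R); split.
  by rewrite expR_gt1 divr_gt0 ?ln_gt0 ?ltr1n ?ltr0n.
move=> alpha S hS [B0 hB0] n1 n2 n3 n4.
(* The infimum of an empty set would be a default value; finite generation of [S] rules this out. *)
apply: lb_le_inf; first by exists (growth_rate R B0), B0.
move=> _ [B hB <-].
have [x [y [xy hx hy]]] := noncommuting_pair K_torsion_free cc hS hB n1 n2 n3 n4.
have [k kN fr] := hN x y xy.
have frK := free_pair_morph (@hnn_in_inj K alpha) fr.
have sx : short B 6 (hnn_in alpha x) by [].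
have sy : short B 6 (hnn_in alpha y) by [].
have inX (z : K) m : hnn_in alpha (z ^+ m) = hnn_in alpha z ^+ m.
  by rewrite -!expgz_nat hnn_in_expgz.
have short_le m m' (z : hnn alpha) : (m <= m')%N -> short B m z -> short B m' z.
  by move=> mm [w [wB wm ez]]; exists w; split => //; exact: leq_trans mm.
have sxk : short B (k * 6) (hnn_in alpha (x ^+ k)) by rewrite inX; exact: shortX.
apply: (growth_rate_free _ hB.1 _ _ _ frK); first by [].
  by apply: short_le sxk; lia.
have e : hnn_in alpha (y * x ^+ k * y^-1)
    = hnn_in alpha y * hnn_in alpha (x ^+ k) * (hnn_in alpha y)^-1.
  by apply: (mulIg (hnn_in alpha y)); rewrite -hnn_inM !mulgVK hnn_inM.
apply: (@short_le (6 + k * 6 + 6)%N); first by lia.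
apply: (eq_ind_r (short B _) _ e).
by apply: shortM; [exact: shortM | exact: shortV].
Qed.
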